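(* Let $p,q>1$, $R>0$, let $B_R\subset\mathbb{R}^n$ be the open ball of radius $R$ centered at the origin, and let $\eta$ be the outward unit normal on $\partial B_R$. Let $u_0,v_0$ be smooth, radially symmetric, nonzero, nonnegative functions on $\overline{B}_R$ such that $\Delta u_0\ge 0$, $\Delta v_0\ge 0$, $u_{0r}(|x|)\ge 0$ and $v_{0r}(|x|)\ge 0$ for $x\in\overline{B}_R$. Let $(u,v)$ be a solution of $$\begin{cases} u_t=\Delta u,\quad v_t=\Delta v, & (x,t)\in B_R\times(0,T),\\ \dfrac{\partial u}{\partial\eta}=e^{v^p},\quad \dfrac{\partial v}{\partial\eta}=e^{u^q}, & (x,t)\in\partial B_R\times(0,T),\\ u(x,0)=u_0(x),\quad v(x,0)=v_0(x), & x\in B_R,\end{cases}$$ which blows up in finite time $T$. Then there exist positive constants $C_1,C_2$ such that $$\max_{x\in\overline{B}_R}u(x,t)\le \log C_1-\frac{\alpha}{2}\log(T-t),\qquad 0<t<T,$$ $$\max_{x\in\overline{B}_R}v(x,t)\le \log C_2-\frac{\beta}{2}\log(T-t),\qquad 0<t<T,$$ where $\alpha=\frac{p+1}{pq-1}$ and $\beta=\frac{q+1}{pq-1}$.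
   Context: Solutions are classical solutions with $u,v\ge 0$: $u,v$ are continuous on $\overline{B}_R\times[0,T)$, twice continuously differentiable in $x$ and once in $t$ in $B_R\times(0,T)$, with spatial gradient continuous up to $\partial B_R$ for $t\in(0,T)$, and the equations hold pointwise. For a radially symmetric function $w$, $w_r$ denotes the derivative with respect to $r=|x|$. ''$(u,v)$ blows up in finite time $T$'' means that $T<\infty$ is the maximal existence time of the solution and $\limsup_{t\to T^-}\left(\max_{\overline{B}_R}u(\cdot,t)+\max_{\overline{B}_R}v(\cdot,t)\right)=\infty$. *)

(* Defs.v *)
From mathcomp Require Import all_boot all_order all_algebra.
From mathcomp Require Import all_classical all_reals all_analysis.
Import Order.TTheory GRing.Theory Num.Theory.
Import numFieldNormedType.Exports.

Set Implicit Arguments.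
Unset Strict Implicit.
Unset Printing Implicit Defensive.

Local Open Scope classical_set_scope.
Local Open Scope ring_scope.

Section Space.
Context {K : realType} {n : nat}.
Implicit Types (R : K) (w : 'rV[K]_n -> K) (x : 'rV[K]_n).

(* The library norm on ['rV[K]_n] is the sup norm, which induces the usual
   topology; balls and radial symmetry refer to the Euclidean norm. *)
Definition enorm x : K := Num.sqrt (\sum_(i < n) x ord0 i ^+ 2).

Definition oball R : set 'rV[K]_n := [set x | enorm x < R].
Definition cball R : set 'rV[K]_n := [set x | enorm x <= R].
Definition bdball R : set 'rV[K]_n := [set x | enorm x = R].

Definition partial (i : 'I_n) w : 'rV[K]_n -> K :=
  fun x => 'D_(delta_mx ord0 i) w x.

Definition has_partial (i : 'I_n) w x : Prop :=
  derivable w x (delta_mx ord0 i).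

Definition laplacian w : 'rV[K]_n -> K :=
  fun x => \sum_(i < n) partial i (partial i w) x.

(* [partials [:: i1; ...; ik] w] is the iterated derivative
   d_{i1} (... (d_{ik} w)). *)
Definition partials (s : seq 'I_n) w : 'rV[K]_n -> K := foldr partial w s.

(* w belongs to C^oo of the closed ball: w is continuous there, and its
   derivatives of all orders exist in the open ball and extend continuously
   to the closed ball. *)
Definition smooth_cball R w : Prop :=
  {within cball R, continuous w} /\
  forall s : seq 'I_n,
    (forall (i : 'I_n) x, oball R x -> has_partial i (partials s w) x) /\
    exists g : 'rV[K]_n -> K,
      {within cball R, continuous g} /\
      (forall x, oball R x -> g x = partials s w x).

Definition radially_symmetric R w : Prop :=
  forall x y, cball R x -> cball R y -> enorm x = enorm y -> w x = w y.

(* For n > 0 the vector (r / sqrt n) (1, ..., 1) has Euclidean norm |r|, so for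
   a radially symmetric w and 0 <= r <= R this is the value of w on |x| = r. *)
Definition radial_profile w (r : K) : K :=
  w ((r / Num.sqrt n%:R) *: const_mx 1).

(* Derivative in r of the profile on [0, R]; one-sided at r = 0 and r = R. *)
Definition radial_deriv R w (r : K) : K :=
  lim ((radial_profile w s - radial_profile w r) / (s - r)
       @[s --> within `[0, R] (r^')]).

(* The supremum is a maximum, since only functions that are continuous on the
   (compact) closed ball are considered. *)
Definition max_cball R w : K := sup [set w x | x in cball R].

End Space.

Section System.
Context {K : realType} {n : nat}.
Implicit Types (R T : K) (w u v : 'rV[K]_n -> K -> K).

Definition uncurried w : 'rV[K]_n * K -> K := fun z => w z.1 z.2.

Definition dt w : 'rV[K]_n -> K -> K := fun x t => derive1 (w x) t.
Definition dx (i : 'I_n) w : 'rV[K]_n -> K -> K :=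
  fun x t => partial i (fun y => w y t) x.

(* C^2 in x and C^1 in t on B_R x (0, T), with derivatives continuous in
   (x, t). *)
Definition C21 R T w : Prop :=
  (forall (x : 'rV[K]_n) (t : K), oball R x -> 0 < t < T ->
     derivable (w x) t 1 /\
     (forall i, has_partial i (fun y => w y t) x) /\
     (forall i j, has_partial j (fun y => dx i w y t) x)) /\
  {within oball R `*` `]0, T[, continuous (uncurried (dt w))} /\
  (forall i, {within oball R `*` `]0, T[, continuous (uncurried (dx i w))}) /\
  (forall i j,
     {within oball R `*` `]0, T[, continuous (uncurried (dx j (dx i w)))}).

(* G is the continuous extension of the spatial gradient of w from
   B_R x (0, T) to (closed ball) x (0, T); by density of B_R such a G is unique
   on that set. *)
Definition gradient_upto_boundary R T w (G : 'I_n -> 'rV[K]_n -> K -> K) :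
    Prop :=
  forall i,
    {within cball R `*` `]0, T[, continuous (uncurried (G i))} /\
    (forall (x : 'rV[K]_n) (t : K), oball R x -> 0 < t < T ->
       G i x t = dx i w x t).

(* G . eta at a boundary point x, where eta = x / R. *)
Definition normal_deriv R (G : 'I_n -> 'rV[K]_n -> K -> K)
    (x : 'rV[K]_n) (t : K) : K :=
  \sum_(i < n) G i x t * (x ord0 i / R).

(* Nonnegative classical solutions on [0, T); the values of u and v outside
   (closed ball) x [0, T) play no role. *)
Definition classical_solution (p q R : K) (u0 v0 : 'rV[K]_n -> K) T u v :
    Prop :=
  [/\ {within cball R `*` `[0, T[, continuous (uncurried u)} /\
      {within cball R `*` `[0, T[, continuous (uncurried v)},
      (forall (x : 'rV[K]_n) (t : K), cball R x -> 0 <= t < T ->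
         0 <= u x t /\ 0 <= v x t),
      C21 R T u /\ C21 R T v,
      (forall (x : 'rV[K]_n) (t : K), oball R x -> 0 < t < T ->
         dt u x t = laplacian (fun y => u y t) x /\
         dt v x t = laplacian (fun y => v y t) x) &
      (exists Gu Gv,
         [/\ gradient_upto_boundary R T u Gu,
             gradient_upto_boundary R T v Gv &
             forall (x : 'rV[K]_n) (t : K), bdball R x -> 0 < t < T ->
               normal_deriv R Gu x t = expR (v x t `^ p) /\
               normal_deriv R Gv x t = expR (u x t `^ q)])
      /\ (forall x, oball R x -> u x 0 = u0 x /\ v x 0 = v0 x)].

(* T is the maximal existence time: the solution has no proper extension. *)
Definition maximal_time (p q R : K) (u0 v0 : 'rV[K]_n -> K) T u v : Prop :=
  ~ exists T' u' v',
      [/\ T < T', classical_solution p q R u0 v0 T' u' v' &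
          forall (x : 'rV[K]_n) (t : K), cball R x -> 0 <= t < T ->
            u' x t = u x t /\ v' x t = v x t].

Definition blows_up_at (p q R : K) (u0 v0 : 'rV[K]_n -> K) T u v : Prop :=
  maximal_time p q R u0 v0 T u v /\
  limf_esup (fun t : K => (max_cball R (fun x => u x t) +
                           max_cball R (fun x => v x t))%:E) (T^'-) = +oo%E.

End System.

(* Main.v *)
Require Import Defs.
From mathcomp Require Import all_boot all_order all_algebra.
From mathcomp Require Import all_classical all_reals all_analysis.
From mathcomp Require Import ring lra.
Import Order.TTheory GRing.Theory Num.Theory.
Import numFieldNormedType.Exports.
Local Open Scope classical_set_scope.
Local Open Scope ring_scope.

(* Let f and g be the boundary values of the radial solution u, v, and let H be
   the radial harmonic function with H = 0 and outward normal derivative -1 on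
   |x| = R.  The stationary profiles A - exp(B^p) H and B - exp(A^q) H form a
   subsolution of the system for all A, B.

   The data need not satisfy the boundary conditions, so u and v need not
   increase in time.  What survives is a sign-change count: since u(0) is
   subharmonic, u - (A - a H) has at most one sign change in |x| at t = 0 when
   f(0) <= A, and this persists as long as the flux of u stays below a whenever
   f > A.  If s is the first time at which f and g reach given levels above
   their initial values, and A = f(s), B = g(s), this forces u(s) and v(s) to
   lie above the two profiles, hence f >= A and g >= B from s on.  So f and g
   are nondecreasing as soon as both exceed their initial values, which happens
   because otherwise an explicit barrier would prevent blow-up.

   Monotonicity gives f(t) >= (n/R) (t - s) exp(g(s)^p) for s <= t, and
   symmetrically for g.  As p, q > 1, the exponentials beat exp(lam g) and
   exp(lam f) for every lam, and iterating on times accumulating at (t + T)/2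
   shows that f(t) + gam ln(T - t) is bounded above for every gam > 0, which is
   more than what is claimed. *)

Set Implicit Arguments.
Unset Strict Implicit.
Unset Printing Implicit Defensive.

(** * Derivatives on the line *)

Section RealLine.
Context {K : realType}.
Implicit Types (g : K -> K) (a d e r s t x : K).

(** Before [s] one of the two boundary values lies below its level, so whenever f > A the flux
    exp(g^p) is at most exp(B^p). This lets the sign-change count persist for every slope a >
    exp(B^p). At time [s] the difference u - (A - a H) then vanishes on |x| = R with negative
    outward derivative, so it is positive just inside the sphere; a negative value anywhere deeper
    would contradict the count. Taking a close to exp(B^p) gives u(s) >= A - exp(B^p) H.

    H is the delicate object: for n >= 2 it is unbounded at the origin, and for n = 1 it has a kink
    there. It is truncated at a high level, which does no harm because u and v are nonnegative, and
    the kink is concave, so no function with second derivatives can touch it from the wrong side.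
    For this reason derivatives and Laplacians are relations at a point, and the minimum principle
    is stated with test functions.

    Radial symmetry is assumed of the data alone. For the solution it follows from uniqueness, by
    comparison with its reflected copies. *)

Lemma is_derive_remainder g x d e : is_derive x 1 g d -> 0 < e ->
  exists2 r, 0 < r & forall h, `|h| < r -> `|g (x + h) - g x - h * d| <= e * `|h|.
Proof.
move=> [/cvg_ex[/= l gl] gd] e0.
have {gd}ld : l = d by rewrite -gd; apply/esym/cvg_lim.
subst l; move/cvgrPdist_le : gl => /(_ e e0).
move=> -[r /= r0 Hr].
exists r => // h hr; have [->|h0] := eqVneq h 0.
  by rewrite addr0 subrr mul0r subrr normr0 mulr0.
have := Hr h; rewrite /ball_ /= sub0r normrN => /(_ hr h0).
rewrite /GRing.scale /= mulr1 distrC [h + x]addrC => H.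
rewrite (_ : _ - _ = (h^-1 * (g (x + h) - g x) - d) * h).
  by rewrite normrM ler_pM2r // normr_gt0.
by rewrite mulrBl mulrAC mulVf // mul1r [d * h]mulrC.
Qed.

Lemma remainder_is_derive g x d :
  (forall e, 0 < e -> exists2 r, 0 < r &
    forall h, `|h| < r -> `|g (x + h) - g x - h * d| <= e * `|h|) ->
  is_derive x 1 g d.
Proof.
move=> H; suff gl : (h^-1 *: ((g \o shift x) (h *: 1) - g x)) @[h --> 0^'] --> d.
  by split; [apply/cvg_ex; exists d|exact/cvg_lim].
apply/cvgrPdist_le => e e0; have [r r0 Hr] := H e e0.
exists r => //= h; rewrite /ball_ /= sub0r normrN => hr h0.
rewrite /GRing.scale /= mulr1 distrC [h + x]addrC.
have := Hr h hr.
rewrite (_ : _ - _ - _ = (h^-1 * (g (x + h) - g x) - d) * h).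
  by rewrite normrM ler_pM2r // normr_gt0.
by rewrite mulrBl mulrAC mulVf // mul1r [d * h]mulrC.
Qed.

Lemma is_derive_quadratic a b k s :
  is_derive s 1 (fun t => a + b * t + k * t ^+ 2) (b + 2 * k * s).
Proof.
apply: remainder_is_derive => e e0.
have k0 : 0 < `|k| + 1 by rewrite ltr_wpDl.
exists (e / (`|k| + 1)); first by rewrite divr_gt0.
move=> h; rewrite ltr_pdivlMr // => hr.
rewrite (_ : _ - _ = k * h * h); last by ring.
rewrite normrM ler_wpM2r // normrM; have := normr_ge0 h; nra.
Qed.

Lemma is_derive_mull k g x d : is_derive x 1 g d ->
  is_derive x 1 (fun s => k * g s) (k * d).
Proof. by move=> gd; exact: is_deriveZ. Qed.

Lemma is_derive_mul g1 g2 x d1 d2 : is_derive x 1 g1 d1 -> is_derive x 1 g2 d2 ->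
  is_derive x 1 (fun s => g1 s * g2 s) (g1 x * d2 + g2 x * d1).
Proof. by move=> gd1 gd2; exact: is_deriveM. Qed.

(** Only the past of [t] enters: a parabolic comparison gives no information after the touching
    time. *)
Lemma left_max_deriv_ge0 g t d r : is_derive t 1 g d -> 0 < r ->
  (forall s, t - r < s <= t -> g s <= g t) -> 0 <= d.
Proof.
move=> gd r0 gmax; rewrite leNgt; apply/negP => d0.
have [|r' r'0 Hr] := @is_derive_remainder g t d (- d / 2) gd; first by lra.
pose h := Num.min r r' / 2.
have h0 : 0 < h by rewrite divr_gt0 // lt_min r0.
have hr : h < r by rewrite ltr_pdivrMr // gt_min; apply/orP; left; lra.
have hr' : h < r' by rewrite ltr_pdivrMr // gt_min; apply/orP; right; lra.
have := Hr (- h); rewrite normrN gtr0_norm // => /(_ hr').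
have := gmax (t - h).
have -> : t - r < t - h <= t by lra.
move=> /(_ isT) g1; rewrite ler_norml => /andP[g2 _]; nra.
Qed.

(** The first derivative is an existential witness, so sums, multiples and local changes of [g]
    never require computing an iterated derivative. *)
Definition derive2_at g a := exists g1 r, [/\ 0 < r,
  (forall s, `|s| < r -> is_derive s 1 g (g1 s)) & is_derive (0 : K) 1 g1 a].

Lemma derive2_at_D g h a b : derive2_at g a -> derive2_at h b ->
  derive2_at (fun s => g s + h s) (a + b).
Proof.
move=> [g1 [r [r0 gd g1a]]] [h1 [r' [r'0 hd h1b]]].
exists (fun s => g1 s + h1 s), (Num.min r r'); split.
- by rewrite lt_min r0.
- move=> s; rewrite lt_min => /andP[sr sr'].
  by have := gd s sr; have := hd s sr' => ? ?; exact: is_deriveD.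
- exact: is_deriveD.
Qed.

Lemma derive2_at_Z g a k : derive2_at g a -> derive2_at (fun s => k * g s) (k * a).
Proof.
move=> [g1 [r [r0 gd g1a]]].
exists (fun s => k * g1 s), r; split => //.
- by move=> s sr; exact: is_derive_mull (gd s sr).
- exact: is_derive_mull.
Qed.

Lemma derive2_at_cst k : derive2_at (fun=> k) 0.
Proof.
by exists (fun=> 0), 1; split => // *; exact: is_derive_cst.
Qed.

Lemma derive2_at_near g h a r : 0 < r -> (forall s, `|s| < r -> g s = h s) ->
  derive2_at g a -> derive2_at h a.
Proof.
move=> r0 gh [g1 [r' [r'0 gd g1a]]].
exists g1, (Num.min r r'); split => //; first by rewrite lt_min r0.
move=> s; rewrite lt_min => /andP[sr sr'].
apply: remainder_is_derive => e e0.
have [r2 r20 Hr2] := is_derive_remainder (gd s sr') e0.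
exists (Num.min r2 (r - `|s|)); first by rewrite lt_min r20 subr_gt0.
move=> k; rewrite lt_min => /andP[kr kr2].
rewrite -!gh//; first exact: Hr2.
by rewrite (le_lt_trans (ler_normD _ _)) // addrC -ltrBrDr.
Qed.

Lemma local_max_derive2_le0 g a r : derive2_at g a -> 0 < r ->
  (forall s, `|s| < r -> g s <= g 0) -> a <= 0.
Proof.
move=> [g1 [r1 [r10 gd g1a]]] r0 gmax; rewrite leNgt; apply/negP => a0.
have g0 : is_derive (0 : K) 1 g (g1 0) by apply: gd; rewrite normr0.
(* The one-sided lemma, applied to [g] and to its reflection, gives both inequalities. *)
have g10 : g1 0 = 0.
  have := left_max_deriv_ge0 g0 r0.
  have gm' : is_derive (0 : K) 1 (fun s => g (- s)) (- g1 0).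
    apply: remainder_is_derive => e e0.
    have [r2 r20 Hr2] := is_derive_remainder g0 e0.
    exists r2 => // h hr; have := Hr2 (- h); rewrite normrN => /(_ hr).
    by rewrite !add0r oppr0 mulrN mulNr.
  have := left_max_deriv_ge0 gm' r0.
  move=> H1 H2; apply/eqP; rewrite eq_le; apply/andP; split.
    rewrite -oppr_ge0; apply: H1 => s /andP[s1 s2]; rewrite oppr0; apply: gmax.
    by rewrite normrN ler0_norm; lra.
  by apply: H2 => s /andP[s1 s2]; apply: gmax; rewrite ler0_norm; lra.
(* With [a > 0], [g1] is positive just to the right of 0, and the mean value theorem lifts [g] above
   [g 0]. *)
have a20 : 0 < a / 2 by lra.
have [r2 r20 Hr2] := is_derive_remainder g1a a20.
pose h := Num.min (Num.min r r1) r2 / 2.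
have h0 : 0 < h by rewrite divr_gt0 // !lt_min r0 r10.
have hh : h * 2 = Num.min (Num.min r r1) r2 by rewrite /h divfK.
have [hr hr1 hr2] : [/\ h < r, h < r1 & h < r2].
  have : h < Num.min (Num.min r r1) r2 by rewrite -hh; lra.
  by rewrite !lt_min => /andP[/andP[-> ->] ->].
have gdh x : x \in `]0, h[ -> is_derive x 1 g (g1 x).
  rewrite in_itv /= => /andP[x0 xh]; apply: gd.
  by rewrite gtr0_norm //; exact: lt_trans hr1.
have gch : {within `[0, h], continuous g}.
  apply: derivable_within_continuous => x; rewrite in_itv /= => /andP[x0 xh].
  have xr : `|x| < r1 by rewrite ger0_norm //; exact: le_lt_trans hr1.
  by case: (gd x xr).
have [c] := MVT h0 gdh gch.
rewrite in_itv /= => /andP[c0 ch]; rewrite subr0 => gc.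
have := Hr2 c; rewrite gtr0_norm // => /(_ (lt_trans ch hr2)).
rewrite add0r g10 subr0 ler_norml => /andP[c1 _].
have gh : g h <= g 0 by apply: gmax; rewrite gtr0_norm.
have g1c : 0 < g1 c by nra.
have : 0 < g1 c * h by rewrite mulr_gt0.
by rewrite -gc; lra.
Qed.

End RealLine.

(** * Laplacian and ray derivatives *)

Section Continuity.
Context {K : realType}.

Lemma within_continuous_comp {S T : topologicalType} (D : set S) (E : set T)
    (f : T -> K) (g : S -> T) :
  {within E, continuous f} -> continuous g -> (forall z, D z -> E (g z)) ->
  {within D, continuous (fun z => f (g z))}.
Proof.
move=> /subspace_continuousP cf cg DE; apply/subspace_continuousP => z Dz.
apply: (@cvg_trans _ (f x @[x --> within E (nbhs (g z))])); last exact: (cf _ (DE z Dz)).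
move=> A /(cg z); rewrite /fmap /within /= /nbhs /=; apply: filterS => x H Dx.
exact: H (DE _ Dx).
Qed.

Lemma continuous_pair {T U V : topologicalType} (f : T -> U) (g : T -> V) :
  continuous f -> continuous g -> continuous (fun x => (f x, g x)).
Proof. by move=> cf cg x; exact: (cvg_pair (cf x) (cg x)). Qed.

Lemma continuous_within {T : topologicalType} (D : set T) (f : T -> K) :
  continuous f -> {within D, continuous f}.
Proof. by move=> cf; exact: continuous_subspaceT. Qed.

Lemma within_continuous_post {T : topologicalType} (D : set T) (f : T -> K) (g : K -> K) :
  {within D, continuous f} -> continuous g -> {within D, continuous (fun z => g (f z))}.
Proof. by move=> cf cg z; exact: (continuous_comp (cf z) (cg _)). Qed.

Lemma within_continuousD {T : topologicalType} (D : set T) (f g : T -> K) :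
  {within D, continuous f} -> {within D, continuous g} ->
  {within D, continuous (fun z => f z + g z)}.
Proof.
move=> /subspace_continuousP cf /subspace_continuousP cg.
by apply/subspace_continuousP => z Dz; apply: cvgD; [exact: cf|exact: cg].
Qed.

Lemma within_continuousM {T : topologicalType} (D : set T) (f g : T -> K) :
  {within D, continuous f} -> {within D, continuous g} ->
  {within D, continuous (fun z => f z * g z)}.
Proof.
move=> /subspace_continuousP cf /subspace_continuousP cg.
by apply/subspace_continuousP => z Dz; apply: cvgM; [exact: cf|exact: cg].
Qed.

Lemma within_continuousN {T : topologicalType} (D : set T) (f : T -> K) :
  {within D, continuous f} -> {within D, continuous (fun z => - f z)}.
Proof.
move=> /subspace_continuousP cf.
by apply/subspace_continuousP => z Dz; apply: cvgN; exact: cf.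
Qed.

Lemma within_continuousW {T : topologicalType} (D E : set T) (f : T -> K) :
  {within E, continuous f} -> (forall z, D z -> E z) -> {within D, continuous f}.
Proof. by move=> cf DE; apply: continuous_subspaceW cf => z; exact: DE. Qed.

Lemma continuous_sum {V : normedModType K} {T : topologicalType} (I : Type) (r : seq I)
    (F : I -> T -> V) :
  (forall i, continuous (F i)) -> continuous (fun x => \sum_(i <- r) F i x).
Proof.
move=> cF; elim: r => [|i r IH].
  rewrite (_ : (fun _ => _) = fun=> 0); first by move=> x; exact: cvg_cst.
  by apply/funext => x; rewrite big_nil.
rewrite (_ : (fun _ => _) = fun x => F i x + \sum_(j <- r) F j x).
  by move=> x; apply: cvgD; [exact: cF|exact: IH].
by apply/funext => x; rewrite big_cons.
Qed.

End Continuity.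

(** * Euclidean balls, the Laplacian at a point, derivatives along rays *)

Section Euclidean.
Context {K : realType} {n : nat}.
Implicit Types (x y z : 'rV[K]_n) (w : 'rV[K]_n -> K) (i : 'I_n) (R L d : K).

Definition sqn x : K := \sum_(i < n) x ord0 i ^+ 2.

Local Notation e i := (delta_mx ord0 i : 'rV[K]_n).

Lemma sqn_ge0 x : 0 <= sqn x.
Proof. by apply: sumr_ge0 => i _; exact: sqr_ge0. Qed.

Lemma enorm_ge0 x : 0 <= enorm x.
Proof. exact: sqrtr_ge0. Qed.

Lemma sqr_enorm x : enorm x ^+ 2 = sqn x.
Proof. by rewrite sqr_sqrtr // sqn_ge0. Qed.

Lemma sqnZ (a : K) x : sqn (a *: x) = a ^+ 2 * sqn x.
Proof. by rewrite /sqn mulr_sumr; apply: eq_bigr => i _; rewrite mxE exprMn. Qed.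

Lemma enormZ (a : K) x : enorm (a *: x) = `|a| * enorm x.
Proof.
by rewrite /enorm -!/(sqn _) sqnZ sqrtrM ?sqr_ge0 // sqrtr_sqr.
Qed.

Lemma enorm_delta i : enorm (e i) = 1.
Proof.
rewrite /enorm (bigD1 i) //= mxE !eqxx expr1n big1 ?addr0 ?sqrtr1 //.
by move=> j jn; rewrite mxE (negbTE jn) andbF expr0n.
Qed.

Lemma enorm_eq0 x : enorm x = 0 -> x = 0.
Proof.
move=> x0; have : sqn x = 0 by rewrite -sqr_enorm x0 expr0n.
move=> /eqP; rewrite psumr_eq0; last by move=> i _; exact: sqr_ge0.
move=> /allP H; apply/rowP => i; rewrite mxE.
by have /eqP/eqP := H i (mem_index_enum i); rewrite sqrf_eq0 => /eqP.
Qed.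

Lemma ler_coord_enorm x i : `|x ord0 i| <= enorm x.
Proof.
rewrite -(@ler_pXn2r _ 2) ?nnegrE ?enorm_ge0 // sqr_enorm real_normK ?num_real //.
by rewrite /sqn (bigD1 i) //= lerDl; apply: sumr_ge0 => j _; exact: sqr_ge0.
Qed.

Lemma sqn_slice x i (s : K) : sqn (x + s *: e i) = sqn x + 2 * x ord0 i * s + s ^+ 2.
Proof.
rewrite /sqn (bigD1 i) //= [in RHS](bigD1 i) //= !mxE !eqxx mulr1 sqrrD.
rewrite (eq_bigr (fun j => x ord0 j ^+ 2)); first by ring.
by move=> j ji; rewrite !mxE (negbTE ji) andbF mulr0 addr0.
Qed.

Lemma continuous_sqn : continuous sqn.
Proof.
apply: continuous_sum => i x.
by apply: (@continuous_comp _ _ _ (fun x : 'rV[K]_n => x ord0 i) (fun s : K => s ^+ 2));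
  [exact: coord_continuous|exact: exprn_continuous].
Qed.

Lemma continuous_enorm : continuous (@enorm K n).
Proof.
by move=> x; apply: (@continuous_comp _ _ _ sqn Num.sqrt);
  [exact: continuous_sqn|exact: sqrt_continuous].
Qed.

Lemma compact_cball R : compact (@cball K n R).
Proof.
apply: bounded_closed_compact.
- exists `|R|; split; first exact: num_real.
  move=> M RM x xR; apply: (@le_trans _ _ R); last first.
    by rewrite (le_trans (ler_norm _)) // ltW.
  rewrite /Num.Def.normr /= mx_normrE; apply/bigmax_leP; split.
    exact: le_trans (enorm_ge0 _) xR.
  by move=> [a i] _ /=; rewrite ord1; exact: le_trans (ler_coord_enorm _ _) xR.
- rewrite /cball (_ : [set _ | _] = enorm @^-1` [set s | s <= R]) //.
  by apply: closed_comp; [move=> x _; exact: continuous_enorm|exact: closed_le].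
Qed.

Lemma open_oball R : open (@oball K n R).
Proof.
rewrite /oball (_ : [set _ | _] = enorm @^-1` [set s | s < R]) //.
by apply: open_comp; [move=> x _; exact: continuous_enorm|exact: open_lt].
Qed.

Lemma cballP R x : cball R x -> oball R x \/ bdball R x.
Proof. by rewrite /cball /oball /bdball /= le_eqVlt => /orP[/eqP|]; [right|left]. Qed.

Lemma oball_cball R x : oball R x -> cball R x.
Proof. exact: ltW. Qed.

Lemma bdball_cball R x : bdball R x -> cball R x.
Proof. by rewrite /bdball /cball /= => ->. Qed.

Lemma sqn_bdball R x : bdball R x -> sqn x = R ^+ 2.
Proof. by rewrite -sqr_enorm => ->. Qed.

Lemma sqn_cball R x : cball R x -> sqn x <= R ^+ 2.
Proof.
rewrite -sqr_enorm => xR; have R0 : 0 <= R by exact: le_trans (enorm_ge0 x) xR.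
by rewrite ler_pXn2r ?nnegrE ?enorm_ge0.
Qed.

Lemma line_nbhs (A : set 'rV[K]_n) x h : open A -> A x ->
  exists2 r : K, 0 < r & forall s : K, `|s| < r -> A (x + s *: h).
Proof.
move=> oA Ax.
have cl : continuous (fun s : K => x + s *: h).
  by move=> s; apply: cvgD; [exact: cvg_cst|apply: cvgZr_tmp; exact: cvg_id].
have : nbhs (0 : K) ((fun s : K => x + s *: h) @^-1` A).
  by apply: cl; rewrite scale0r addr0; exact: open_nbhs_nbhs.
move=> /nbhs_ballP[r /= r0 Hr]; exists r => // s sr; apply: Hr.
by rewrite /ball /= sub0r normrN.
Qed.

(** The Laplacian at the single point [x], through second derivatives along the axes. This is all
    that a maximum principle needs, and it applies to functions that are not smooth elsewhere, such
    as truncated barriers. *)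
Definition has_lap w x L := exists a : 'I_n -> K,
  (forall i, derive2_at (fun s => w (x + s *: e i)) (a i)) /\ L = \sum_i a i.

Lemma has_lapD w w' x L L' : has_lap w x L -> has_lap w' x L' ->
  has_lap (fun y => w y + w' y) x (L + L').
Proof.
move=> [a [ha ->]] [b [hb ->]]; exists (fun i => a i + b i); split.
  by move=> i; exact: derive2_at_D.
by rewrite big_split.
Qed.

Lemma has_lapZ k w x L : has_lap w x L -> has_lap (fun y => k * w y) x (k * L).
Proof.
move=> [a [ha ->]]; exists (fun i => k * a i); split.
  by move=> i; exact: derive2_at_Z.
by rewrite mulr_sumr.
Qed.

Lemma has_lap_cst k x : has_lap (fun=> k) x 0.
Proof.
exists (fun=> 0); split; last by rewrite big1.
by move=> i; exact: derive2_at_cst.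
Qed.

Lemma has_lap_local (A : set 'rV[K]_n) w w' x L : open A -> A x ->
  (forall y, A y -> w y = w' y) -> has_lap w x L -> has_lap w' x L.
Proof.
move=> oA Ax ww' [a [ha ->]]; exists a; split => // i.
have [r r0 Hr] := line_nbhs (e i) oA Ax.
by apply: (derive2_at_near r0) (ha i) => s /Hr /ww'.
Qed.

Lemma has_lap_max (A : set 'rV[K]_n) w x L : open A -> A x ->
  (forall y, A y -> w y <= w x) -> has_lap w x L -> L <= 0.
Proof.
move=> oA Ax wx [a [ha ->]]; apply: sumr_le0 => i _.
have [r r0 Hr] := line_nbhs (e i) oA Ax.
apply: (local_max_derive2_le0 (ha i) r0) => s /Hr /wx.
by rewrite scale0r addr0.
Qed.

Lemma has_lap_min (A : set 'rV[K]_n) w x L : open A -> A x ->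
  (forall y, A y -> w x <= w y) -> has_lap w x L -> 0 <= L.
Proof.
move=> oA Ax wx /(has_lapZ (-1)) wL; rewrite -oppr_le0 -mulN1r.
by apply: (has_lap_max oA Ax) wL => y /wx; rewrite !mulN1r lerN2.
Qed.

(** By the chain rule the second derivative along axis [i] is 2 c' + 4 x_i^2 c''. Radial functions
    are written in the variable |x|^2, which is smooth at the origin. *)
Lemma has_lap_radial (c c1 : K -> K) (c2 r : K) x : 0 < r ->
  (forall s, `|s - sqn x| < r -> is_derive s 1 c (c1 s)) ->
  is_derive (sqn x) 1 c1 c2 ->
  has_lap (fun y => c (sqn y)) x (2 * n%:R * c1 (sqn x) + 4 * sqn x * c2).
Proof.
move=> r0 dc dc1.
exists (fun i => 2 * c1 (sqn x) + 4 * x ord0 i ^+ 2 * c2); split; last first.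
  rewrite big_split /= sumr_const card_ord -mulr_natr -mulr_suml -mulr_sumr.
  by rewrite /sqn; ring.
move=> i.
pose P (s : K) := sqn x + 2 * x ord0 i * s + s ^+ 2.
have dP (s : K) : is_derive s 1 P (2 * x ord0 i + 2 * s).
  have := is_derive_quadratic (sqn x) (2 * x ord0 i) 1 s.
  by rewrite mulr1; under eq_fun do rewrite mul1r.
have [r1 r10 Hr1] : exists2 r1 : K, 0 < r1 & forall s, `|s| < r1 -> `|P s - sqn x| < r.
  have Pc : {for 0, continuous P}.
    by apply: differentiable_continuous; apply/derivable1_diffP; case: (dP 0).
  have := Pc _ (@nbhsx_ballx _ _ (P 0) _ r0); rewrite /P mulr0 expr0n !addr0 -/P.
  move=> /nbhs_ballP[r1 /= r10 Hr1]; exists r1 => // s sr1.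
  by have := Hr1 s; rewrite /ball /= sub0r normrN distrC; apply.
exists (fun s => c1 (P s) * (2 * x ord0 i + 2 * s)), r1; split => //.
- move=> s sr1; under eq_fun do rewrite sqn_slice.
  by apply: (@is_derive1_comp _ c P); apply: dc; exact: Hr1.
- have dc1P : is_derive (0 : K) 1 (c1 \o P) (c2 * (2 * x ord0 i + 2 * 0)).
    by apply: is_derive1_comp; rewrite /P mulr0 expr0n !addr0.
  have dl : is_derive (0 : K) 1 (fun s => 2 * x ord0 i + 2 * s) 2.
    have := is_derive_quadratic (2 * x ord0 i) 2 0 0.
    by rewrite !mulr0 addr0; under eq_fun do rewrite mul0r addr0.
  have H := is_deriveM dc1P dl.
  apply: is_derive_eq H _; rewrite /GRing.scale /= /P !mulr0 expr0n !addr0; ring.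
Qed.

(* At a point [x] of the sphere of radius [R], [d] is [R] times the outward
   normal derivative. *)
Definition ray_deriv w x d := forall eps : K, 0 < eps -> exists2 r : K, 0 < r &
  forall h : K, 0 < h < r -> `|w x - w ((1 - h) *: x) - h * d| <= eps * h.

Lemma ray_derivD w w' x d d' : ray_deriv w x d -> ray_deriv w' x d' ->
  ray_deriv (fun y => w y + w' y) x (d + d').
Proof.
move=> wd wd' eps eps0; have eps20 : 0 < eps / 2 by rewrite divr_gt0.
have [r r0 Hr] := wd _ eps20; have [r' r'0 Hr'] := wd' _ eps20.
exists (Num.min r r'); first by rewrite lt_min r0.
move=> h /andP[h0]; rewrite lt_min => /andP[hr hr'].
have := Hr h; rewrite h0 => /(_ hr) H; have := Hr' h; rewrite h0 => /(_ hr') H'.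
rewrite (_ : _ - _ = (w x - w ((1 - h) *: x) - h * d) +
  (w' x - w' ((1 - h) *: x) - h * d')); last by ring.
rewrite (_ : eps * h = eps / 2 * h + eps / 2 * h); last by field.
exact: le_trans (ler_normD _ _) (lerD H H').
Qed.

Lemma ray_derivZ k w x d : ray_deriv w x d -> ray_deriv (fun y => k * w y) x (k * d).
Proof.
move=> wd eps eps0; have k0 : 0 < `|k| + 1 by rewrite ltr_wpDl.
have [r r0 Hr] := wd _ (divr_gt0 eps0 k0).
exists r => // h hr; have := Hr h hr; case/andP: hr => h0 _ H.
rewrite (_ : _ - _ = k * (w x - w ((1 - h) *: x) - h * d)); last by ring.
rewrite normrM; have -> : eps * h = (`|k| + 1) * (eps / (`|k| + 1) * h).
  by field; rewrite gt_eqF.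
by apply: ler_pM => //; rewrite lerDl.
Qed.

Lemma ray_deriv_cst k x : ray_deriv (fun=> k) x 0.
Proof.
move=> eps eps0; exists 1 => // h /andP[h0 _].
by rewrite subrr mulr0 subrr normr0 mulr_ge0 // ltW.
Qed.

Lemma ray_deriv_radial (c : K -> K) (c1 : K) x : is_derive (sqn x) 1 c c1 ->
  ray_deriv (fun y => c (sqn y)) x (2 * sqn x * c1).
Proof.
move=> dc eps eps0.
pose P (h : K) := (1 - h) ^+ 2 * sqn x.
have dP : is_derive (0 : K) 1 P (- 2 * sqn x).
  have := is_derive_quadratic (sqn x) (- 2 * sqn x) (sqn x) 0.
  rewrite mulr0 addr0 (_ : (fun _ => _) = P) //.
  by apply/funext => t; rewrite /P; ring.
have dcP : is_derive (0 : K) 1 (c \o P) (c1 * (- 2 * sqn x)).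
  by apply: is_derive1_comp; rewrite /P subr0 expr1n mul1r.
have [r r0 Hr] := is_derive_remainder dcP eps0.
exists r => // h /andP[h0 hr].
have := Hr h; rewrite (gtr0_norm h0) => /(_ hr) /=.
rewrite /P add0r subr0 expr1n mul1r sqnZ -normrN => H.
by apply: le_trans H; rewrite le_eqVlt; apply/orP; left; apply/eqP; congr `|_|; ring.
Qed.

Lemma ray_deriv_le0 w x d (r : K) : ray_deriv w x d -> 0 < r ->
  (forall h, 0 < h < r -> w x <= w ((1 - h) *: x)) -> d <= 0.
Proof.
move=> wd r0 wx; rewrite leNgt; apply/negP => d0.
have [|r' r'0 Hr'] := wd (d / 2); first by rewrite divr_gt0.
pose h := Num.min r r' / 2.
have h0 : 0 < h by rewrite divr_gt0 // lt_min r0.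
have : h < Num.min r r' by rewrite ltr_pdivrMr // ltr_pMr ?ltr1n // lt_min r0.
rewrite lt_min => /andP[hr hr'].
have := Hr' h; rewrite h0 hr' ler_norml => /(_ isT) /andP[H _].
have := wx h; rewrite h0 hr => /(_ isT) H'; nra.
Qed.

End Euclidean.

(** * Minimum principle for cooperative systems *)

Section MinimumPrinciple.
Context {K : realType} {n : nat}.
Implicit Types (x y : 'rV[K]_n) (w H : 'rV[K]_n -> K) (i : 'I_n) (R L d s t : K)
  (xi : 'rV[K]_n -> K -> K).

Local Notation e i := (delta_mx ord0 i : 'rV[K]_n).

(* Supersolution of the heat equation at [(x, t)] in the viscosity sense: the
   test function touching from below is [- w]. This form also covers kinks. *)
Definition super_at xi x t := forall (A : set 'rV[K]_n) (w' : 'rV[K]_n -> K -> K) (r Dw Lw : K),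
  open A -> A x -> 0 < r ->
  is_derive t 1 (w' x) Dw -> has_lap (w'^~ t) x Lw ->
  (forall y, A y -> xi x t + w' x t <= xi y t + w' y t) ->
  (forall s, t - r < s <= t -> xi x t + w' x t <= xi x s + w' x s) ->
  Dw <= Lw.

Lemma super_at_regular xi x t D L : is_derive t 1 (xi x) D ->
  has_lap (xi^~ t) x L -> L <= D -> super_at xi x t.
Proof.
move=> dD hL LD A w r Dw Lw oA Ax r0 dw hw xmin tmin.
have L0 := has_lap_min oA Ax xmin (has_lapD hL hw).
have dneg : is_derive t 1 (fun s => - (xi x s + w x s)) (- (D + Dw)).
  by apply: is_deriveN; apply: is_deriveD.
have : 0 <= - (D + Dw).
  by apply: (left_max_deriv_ge0 dneg r0) => s /tmin; rewrite lerN2.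
lra.
Qed.

(** A concave kink along one axis, as R - |x| has at the origin in dimension one. *)
Definition peak H x := exists i k, 0 < k /\ forall s : K, H (x + s *: e i) <= H x - k * `|s|.

(** Add the inequalities at the two points [x + h e_i] and [x - h e_i]: the linear part of [g]
    cancels, its remainders total at most a k h, and the kink loses 2 a k h. *)
Lemma peak_no_min H g (A : set 'rV[K]_n) x L (a : K) : has_lap g x L -> peak H x ->
  0 < a -> open A -> A x -> (forall y, A y -> g x + a * H x <= g y + a * H y) -> False.
Proof.
move=> [b [hb _]] [i [k [k0 Hk]]] a0 oA Ax xmin.
have [g1 [r1 [r10 gd _]]] := hb i.
have g0 := gd 0; rewrite normr0 in g0; have {}g0 := g0 r10.
have ak : 0 < a * k / 2 by rewrite divr_gt0 // mulr_gt0.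
have [r2 r20 Hr2] := is_derive_remainder g0 ak.
have [r3 r30 Hr3] := line_nbhs (e i) oA Ax.
pose h := Num.min r2 r3 / 2.
have h0 : 0 < h by rewrite divr_gt0 // lt_min r20.
have : h < Num.min r2 r3 by rewrite ltr_pdivrMr // ltr_pMr ?ltr1n // lt_min r20.
rewrite lt_min => /andP[hr2 hr3].
have hN : `|- h| = h by rewrite normrN gtr0_norm.
have hP : `|h| = h by rewrite gtr0_norm.
have := Hr2 h; rewrite hP => /(_ hr2); rewrite add0r scale0r addr0 ler_norml => /andP[_ H1].
have := Hr2 (- h); rewrite hN => /(_ hr2); rewrite add0r scale0r addr0 ler_norml => /andP[_ H2].
have := xmin _ (Hr3 h _); rewrite hP => /(_ hr3) H3.
have := xmin _ (Hr3 (- h) _); rewrite hN => /(_ hr3) H4.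
have := Hk h; rewrite hP => H5; have := Hk (- h); rewrite hN => H6.
have H7 : a * H (x + h *: e i) <= a * (H x - k * h) by rewrite ler_pM2l.
have H8 : a * H (x + - h *: e i) <= a * (H x - k * h) by rewrite ler_pM2l.
have akh : 0 < a * k * h by apply: mulr_gt0 => //; exact: mulr_gt0.
lra.
Qed.

(** Vacuous: no test function can touch at a concave kink. *)
Lemma super_at_peak u H x t L (a : K) : has_lap (u^~ t) x L -> peak H x -> 0 < a ->
  super_at (fun y s => u y s + a * H y) x t.
Proof.
move=> hu pH a0 A w r Dw Lw oA Ax r0 dw hw xmin _; exfalso.
apply: (peak_no_min (has_lapD hu hw) pH a0 oA Ax) => y /xmin /=.
lra.
Qed.

(** Divide both components by the weight W = exp(kap (t' - s) + lam |x|^2) and take the least value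
    of the quotients over both. If it is -mu < 0, then mu W touches from below in the sense of
    [super_at]. The weight grows too fast in time for an interior touching, and too fast towards the
    sphere for the coupling [Lam] to allow one there. *)
Lemma system_min_principle R s t (Lam : K) (xi : bool -> 'rV[K]_n -> K -> K) :
  0 < R -> 0 <= Lam ->
  (forall b, {within cball R `*` `[s, t], continuous (uncurried (xi b))}) ->
  (forall b x, cball R x -> 0 <= xi b x s) ->
  (forall b x t', oball R x -> s < t' <= t -> xi b x t' < 0 -> super_at (xi b) x t') ->
  (forall b x t', bdball R x -> s < t' <= t -> xi b x t' < 0 ->
    exists2 d, ray_deriv (xi b ^~ t') x d & Lam * Num.min (xi (~~ b) x t') 0 <= d) ->
  forall b x t', cball R x -> s <= t' <= t -> 0 <= xi b x t'.
Proof.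
move=> R0 Lam0 cxi xi0 xiint xibd.
(* The ray derivative of W on the sphere is 2 R^2 lam W = (Lam + 1) W, one W more than the coupling
   can cost. *)
pose lam := (Lam + 1) / (2 * R ^+ 2).
have R20 : 0 < R ^+ 2 by rewrite exprn_gt0.
have lam0 : 0 < lam by rewrite divr_gt0 ?mulr_gt0 // ltr_wpDl.
have lamR : 2 * R ^+ 2 * lam = Lam + 1.
  by rewrite /lam mulrC divfK // gt_eqF // mulr_gt0.
(* One more than the largest value of (Laplacian of W) / W on the ball. *)
pose kap := 2 * n%:R * lam + 4 * R ^+ 2 * lam ^+ 2 + 1.
pose E (x : 'rV[K]_n) (t' : K) := kap * (t' - s) + lam * sqn x.
pose W x t' := expR (E x t').
have W0 x t' : 0 < W x t' by exact: expR_gt0.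
have cE : continuous (uncurried E).
  move=> z; rewrite /uncurried /E /=; apply: cvgD; apply: cvgM; try exact: cvg_cst.
    by apply: cvgB; [exact: cvg_snd|exact: cvg_cst].
  by apply: (@continuous_comp _ _ _ (@fst _ _) sqn); [exact: cvg_fst|exact: continuous_sqn].
pose Q b (z : 'rV[K]_n * K) := xi b z.1 z.2 * expR (- E z.1 z.2).
have cQ b : {within cball R `*` `[s, t], continuous (Q b)}.
  apply: within_continuousM; first exact: cxi.
  apply: continuous_within => z.
  apply: (@continuous_comp _ _ _ (fun z => - uncurried E z) expR); last exact: continuous_expR.
  by apply: cvgN; exact: cE.
have cpt : compact (cball R `*` `[s, t] : set ('rV[K]_n * K)).
  by apply: compact_setX; [exact: compact_cball|exact: segment_compact].
move=> b0 y0 t0 y0R t0st; rewrite leNgt; apply/negP => neg.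
have ne0 : (cball R `*` `[s, t] : set ('rV[K]_n * K)) !=set0.
  by exists (y0, t0); split => //=; rewrite in_itv.
have minb b : exists2 z, (cball R `*` `[s, t]) z &
    forall z', (cball R `*` `[s, t]) z' -> Q b z <= Q b z'.
  have [z] := compact_EVT_min ne0 cpt (cQ b).
  rewrite inE => Dz Hz; exists z => // z' Dz'; apply: Hz; exact/mem_set.
(* The minimum runs over both components, so that the same [mu] bounds each of them below by -mu
   W. *)
have [b [[x1 t1] D1 Q1]] : exists b, exists2 z, (cball R `*` `[s, t]) z &
    forall b' z', (cball R `*` `[s, t]) z' -> Q b z <= Q b' z'.
  have [zt Dt Ht] := minb true; have [zf Df Hf] := minb false.
  have [le|/ltW le] := lerP (Q true zt) (Q false zf).
    exists true, zt => // -[] z' Dz'; first exact: Ht.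
    exact: le_trans le (Hf _ Dz').
  exists false, zf => // -[] z' Dz'; last exact: Hf.
  exact: le_trans le (Ht _ Dz').
case: D1 => /= x1R; rewrite in_itv /= => /andP[st1 t1t].
pose mu := - Q b (x1, t1).
have mu0 : 0 < mu.
  rewrite oppr_gt0; apply: le_lt_trans (Q1 b0 (y0, t0) _) _.
    by split => //=; rewrite in_itv.
  by rewrite /Q /= pmulr_llt0 // expR_gt0.
have xiQ b' x t' : xi b' x t' = Q b' (x, t') * W x t'.
  by rewrite /Q /W /= -mulrA -expRD addNr expR0 mulr1.
have touch : xi b x1 t1 + mu * W x1 t1 = 0.
  by rewrite xiQ /mu; ring.
have above b' x t' : cball R x -> s <= t' <= t -> 0 <= xi b' x t' + mu * W x t'.
  move=> xR t'st; rewrite xiQ -mulrDl pmulr_lge0 // /mu subr_ge0.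
  by apply: Q1; split => //=; rewrite in_itv.
have neg1 : xi b x1 t1 < 0 by have := mulr_gt0 mu0 (W0 x1 t1); lra.
have {}st1 : s < t1.
  rewrite lt_neqAle st1 andbT; apply/eqP => st; move: neg1.
  by rewrite -st ltNge xi0.
pose c (S : K) := expR (kap * (t1 - s) + lam * S).
have dc S : is_derive (S : K) 1 c (lam * c S).
  rewrite mulrC; apply: (@is_derive1_comp _ expR).
  have := is_derive_quadratic (kap * (t1 - s)) lam 0 S.
  by rewrite !mulr0 mul0r addr0; under eq_fun do rewrite mul0r addr0.
case: (cballP x1R) => [x1i|x1b].
- have lapW : has_lap (fun y => mu * W y t1) x1
      (mu * (2 * n%:R * (lam * c (sqn x1)) + 4 * sqn x1 * (lam * (lam * c (sqn x1))))).
    apply: has_lapZ; apply: (has_lap_radial (c := c) (c1 := fun S => lam * c S) ltr01) => //.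
  have derW : is_derive t1 1 (fun t' => mu * W x1 t') (mu * (kap * W x1 t1)).
    suff dWt : is_derive t1 1 (W x1) (kap * W x1 t1) by exact: is_derive_mull.
    have dE : is_derive t1 1 (E x1) kap.
      have := is_derive_quadratic (lam * sqn x1 - kap * s) kap 0 t1.
      rewrite mulr0 mul0r addr0 (_ : (fun _ => _) = E x1) //.
      by apply/funext => t'; rewrite /E; ring.
    have := is_derive1_comp (is_derive_expR (E x1 t1)) dE.
    by rewrite [_ * kap]mulrC.
  (* With mu W as test function, [super_at] would give kap W <= Laplacian of W. *)
  have := xiint b x1 t1 x1i _ neg1; rewrite st1 t1t => /(_ isT).
  have ts0 : 0 < t1 - s by rewrite subr_gt0.
  move=> /(_ (oball R) (fun x t' => mu * W x t') _ _ _ (@open_oball K n R) x1i ts0 derW lapW).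
  have Hx : forall y, oball R y -> xi b x1 t1 + mu * W x1 t1 <= xi b y t1 + mu * W y t1.
    by move=> y yR; rewrite touch above ?(ltW st1) //; exact: oball_cball.
  have Ht : forall t', t1 - (t1 - s) < t' <= t1 ->
      xi b x1 t1 + mu * W x1 t1 <= xi b x1 t' + mu * W x1 t'.
    move=> t' /andP[st' t't1]; rewrite touch above //.
    by rewrite (le_trans t't1 t1t) andbT; lra.
  move=> /(_ Hx Ht); rewrite -/(c (sqn x1)) ler_pM2l //.
  have c0 : 0 < c (sqn x1) by exact: expR_gt0.
  have -> : 2 * n%:R * (lam * c (sqn x1)) + 4 * sqn x1 * (lam * (lam * c (sqn x1))) =
      (2 * n%:R * lam + 4 * sqn x1 * lam ^+ 2) * c (sqn x1) by ring.
  have H2 : 4 * sqn x1 * lam ^+ 2 <= 4 * R ^+ 2 * lam ^+ 2.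
    by rewrite ler_pM2r ?exprn_gt0 // ler_pM2l // sqn_cball.
  rewrite ler_pM2r // /kap => H1; lra.
- have st1t : s < t1 <= t by rewrite st1.
  have [d dxi dLam] := xibd b x1 t1 x1b st1t neg1.
  have dW : ray_deriv (fun y => mu * W y t1) x1 (mu * (2 * sqn x1 * (lam * c (sqn x1)))).
    by apply: ray_derivZ; exact: (ray_deriv_radial (c := c)).
  have := ray_deriv_le0 (ray_derivD dxi dW) ltr01.
  have Hh : forall h, 0 < h < 1 ->
      xi b x1 t1 + mu * W x1 t1 <= xi b ((1 - h) *: x1) t1 + mu * W ((1 - h) *: x1) t1.
    move=> h /andP[h0 h1]; rewrite touch above ?(ltW st1) //.
    rewrite /cball /= enormZ ger0_norm; last by lra.
    by rewrite (x1b : enorm x1 = R); have := mulr_gt0 h0 R0; lra.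
  move=> /(_ Hh); rewrite (sqn_bdball x1b).
  have Wc : W x1 t1 = c (R ^+ 2) by rewrite /c -(sqn_bdball x1b).
  have c0 : 0 < c (R ^+ 2) by exact: expR_gt0.
  (* The other component is at least -mu W here, so the coupling contributes at least -Lam mu W. *)
  have := above (~~ b) x1 t1 x1R _; rewrite (ltW st1) t1t => /(_ isT); rewrite Wc => ab.
  have ab2 : - (mu * c (R ^+ 2)) <= Num.min (xi (~~ b) x1 t1) 0.
    rewrite le_min; apply/andP; split; first by lra.
    by rewrite oppr_le0 mulr_ge0 // ltW.
  have ab3 := ler_wpM2l Lam0 ab2.
  have : mu * (2 * R ^+ 2 * (lam * c (R ^+ 2))) = mu * (Lam + 1) * c (R ^+ 2).
    by rewrite -lamR; ring.
  have mLam : mu * (Lam + 1) * c (R ^+ 2) = Lam * (mu * c (R ^+ 2)) + mu * c (R ^+ 2) by ring.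
  have := mulr_gt0 mu0 c0; lra.
Qed.

End MinimumPrinciple.

(** * Counting sign changes *)

Section SingleCrossing.
Context {K : realType} {n : nat}.
Implicit Types (x y z : 'rV[K]_n) (w : 'rV[K]_n -> K) (R D L d s t : K)
  (xi : 'rV[K]_n -> K -> K).

Lemma continuous_pos_part : continuous (fun a : K => Num.max a 0).
Proof.
rewrite (_ : (fun a : K => _) = fun a => (a + `|a|) * 2^-1).
  move=> a; apply: cvgM; last exact: cvg_cst.
  by apply: cvgD; [exact: cvg_id|exact: norm_continuous].
apply/funext => a; case: (lerP a 0) => a0.
  by rewrite ler0_norm // subrr mul0r.
by rewrite gtr0_norm //; field.
Qed.

(* The product [xi^+(x, s) xi^-(y, s)] solves the heat equation in [(x, y)]
   where it is positive, so it has no positive maximum on [|y| <= |x| <= R]. *)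
Lemma single_crossing R t xi : 0 < R ->
  {within cball R `*` `[0, t], continuous (uncurried xi)} ->
  (forall x y s, cball R x -> cball R y -> 0 <= s <= t -> enorm x = enorm y ->
    xi x s = xi y s) ->
  (forall x y s, oball R x -> 0 < s <= t -> enorm y < enorm x -> xi y s < 0 ->
    exists2 D : K, is_derive s 1 (xi x) D & has_lap (xi^~ s) x D) ->
  (forall y s, oball R y -> 0 < s <= t -> xi y s < 0 ->
    (exists2 D : K, is_derive s 1 (xi y) D & has_lap (xi^~ s) y D) \/
    (forall A : set 'rV[K]_n, open A -> A y -> ~ forall z, A z -> xi y s <= xi z s)) ->
  (forall x s, bdball R x -> 0 < s <= t -> 0 < xi x s ->
    exists2 d, ray_deriv (xi^~ s) x d & d < 0) ->
  (forall x y, cball R x -> cball R y -> enorm y <= enorm x -> xi y 0 < 0 -> xi x 0 <= 0) ->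
  0 <= t -> forall x y, cball R x -> cball R y -> enorm y <= enorm x ->
    xi y t < 0 -> xi x t <= 0.
Proof.
move=> R0 cxi rad int1 int2 bd init t0 x0 y0 x0R y0R yx0 yneg.
rewrite leNgt; apply/negP => xpos.
pose Dom := [set z : ('rV[K]_n * 'rV[K]_n) * K |
  [/\ cball R z.1.1, cball R z.1.2, enorm z.1.2 <= enorm z.1.1 & 0 <= z.2 <= t]].
have cf1 : continuous (fun z : ('rV[K]_n * 'rV[K]_n) * K => z.1.1).
  by move=> z; apply: continuous_comp; exact: cvg_fst.
have cf2 : continuous (fun z : ('rV[K]_n * 'rV[K]_n) * K => z.1.2).
  by move=> z; apply: continuous_comp; [exact: cvg_fst|exact: cvg_snd].
have cs : continuous (fun z : ('rV[K]_n * 'rV[K]_n) * K => z.2).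
  by move=> z; exact: cvg_snd.
have cptD : compact Dom.
  have cpt := compact_setX (compact_setX (@compact_cball K n R) (@compact_cball K n R))
    (@segment_compact K 0 t).
  apply: (subclosed_compact _ cpt); last first.
    by move=> [[x y] s] [/= xR yR _ st]; split => //=; rewrite in_itv.
  rewrite (_ : Dom = ((fun z : ('rV[K]_n * 'rV[K]_n) * K => z.1.1) @^-1` cball R `&`
     (fun z : ('rV[K]_n * 'rV[K]_n) * K => z.1.2) @^-1` cball R) `&`
     ((fun z : ('rV[K]_n * 'rV[K]_n) * K => enorm z.1.1 - enorm z.1.2) @^-1` [set a | 0 <= a] `&`
     (fun z : ('rV[K]_n * 'rV[K]_n) * K => z.2) @^-1` `[0, t]%classic)); last first.
    apply/seteqP; split => -[[x y] s] /=.
      by move=> [? ? ? ?]; rewrite in_itv subr_ge0.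
    by rewrite in_itv subr_ge0 /= => -[[? ?] [? ?]].
  have clR : closed (@cball K n R).
    by apply: compact_closed; [exact: norm_hausdorff|exact: compact_cball].
  apply: closedI; apply: closedI; apply: closed_comp.
  - by move=> z _; exact: cf1.
  - exact: clR.
  - by move=> z _; exact: cf2.
  - exact: clR.
  - move=> z _; apply: cvgB.
      by apply: (continuous_comp (cf1 z)); exact: continuous_enorm.
    by apply: (continuous_comp (cf2 z)); exact: continuous_enorm.
  - exact: closed_ge.
  - by move=> z _; exact: cs.
  - exact: itv_closed.
pose U (z : ('rV[K]_n * 'rV[K]_n) * K) := Num.max (xi z.1.1 z.2) 0.
pose V (z : ('rV[K]_n * 'rV[K]_n) * K) := Num.max (- xi z.1.2 z.2) 0.
(* The factor exp(-s) makes the time derivative of the product strictly negative at an interior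
   maximum, where the heat equation alone gives only a weak inequality. *)
pose Th (z : ('rV[K]_n * 'rV[K]_n) * K) := expR (- z.2) * (U z * V z).
have cxi1 : {within Dom, continuous (fun z : ('rV[K]_n * 'rV[K]_n) * K => xi z.1.1 z.2)}.
  apply: (@within_continuous_comp _ _ _ _ _ (uncurried xi)
    (fun z : ('rV[K]_n * 'rV[K]_n) * K => (z.1.1, z.2)) cxi).
    by move=> z; exact: (cvg_pair (cf1 z) (cs z)).
  by move=> [[x y] s] [/= ? ? ? ?]; split => //=; rewrite in_itv.
have cxi2 : {within Dom, continuous (fun z : ('rV[K]_n * 'rV[K]_n) * K => xi z.1.2 z.2)}.
  apply: (@within_continuous_comp _ _ _ _ _ (uncurried xi)
    (fun z : ('rV[K]_n * 'rV[K]_n) * K => (z.1.2, z.2)) cxi).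
    by move=> z; exact: (cvg_pair (cf2 z) (cs z)).
  by move=> [[x y] s] [/= ? ? ? ?]; split => //=; rewrite in_itv.
have cpos (f : ('rV[K]_n * 'rV[K]_n) * K -> K) : {within Dom, continuous f} ->
    {within Dom, continuous (fun q => Num.max (f q) 0)}.
  by move=> cf; exact: within_continuous_post cf continuous_pos_part.
have cTh : {within Dom, continuous Th}.
  apply: within_continuousM.
    apply: continuous_within => z.
    apply: (@continuous_comp _ _ _ (fun z : ('rV[K]_n * 'rV[K]_n) * K => - z.2) expR);
      last exact: continuous_expR.
    by apply: cvgN; exact: cs.
  by apply: within_continuousM; apply: cpos => //; exact: within_continuousN.
have ne0 : Dom !=set0 by exists ((x0, y0), t); split => //=; rewrite t0 lexx.
have [[[x1 y1] s1]] := compact_EVT_max ne0 cptD cTh.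
rewrite inE => -[/= x1R y1R yx1 /andP[s10 s1t]] Thmax.
have {}Thmax x y s : cball R x -> cball R y -> enorm y <= enorm x -> 0 <= s <= t ->
  expR (- s) * (Num.max (xi x s) 0 * Num.max (- xi y s) 0) <=
  expR (- s1) * (Num.max (xi x1 s1) 0 * Num.max (- xi y1 s1) 0).
  by move=> xR yR xy st; apply: (Thmax ((x, y), s)); rewrite inE; split.
have Thpos : 0 < expR (- s1) * (Num.max (xi x1 s1) 0 * Num.max (- xi y1 s1) 0).
  apply: lt_le_trans (Thmax x0 y0 t x0R y0R yx0 _); last by rewrite t0 lexx.
  by rewrite !mulr_gt0 ?expR_gt0 // lt_max ?xpos // oppr_gt0 yneg.
have Upos : 0 < xi x1 s1.
  rewrite ltNge; apply/negP => le0; move: Thpos.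
  by rewrite (max_idPr le0) mul0r mulr0 ltxx.
have Vpos : xi y1 s1 < 0.
  rewrite ltNge; apply/negP => le0; move: Thpos.
  by rewrite [X in _ * (_ * X)](max_idPr _) ?oppr_le0 // !mulr0 ltxx.
have Upos' : 0 < Num.max (xi x1 s1) 0 by rewrite lt_max Upos.
have Vpos' : 0 < Num.max (- xi y1 s1) 0 by rewrite lt_max oppr_gt0 Vpos.
(* On |y| = |x| radial symmetry forbids opposite signs, so this part of the boundary of the domain
   is excluded. *)
have yx1' : enorm y1 < enorm x1.
  rewrite lt_neqAle yx1 andbT; apply/eqP => /rad - /(_ s1 y1R x1R).
  by rewrite s10 s1t => /(_ isT) E; move: Upos; rewrite -E ltNge (ltW Vpos).
have {}s10 : 0 < s1.
  rewrite lt_neqAle s10 andbT; apply/eqP => E; move: Upos Vpos; rewrite -E => Upos Vpos.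
  by have := init x1 y1 x1R y1R yx1 Vpos; rewrite leNgt Upos.
have s1I : 0 < s1 <= t by rewrite s10.
have s1I' : 0 <= s1 <= t by rewrite ltW.
have xmax z : cball R z -> enorm y1 < enorm z -> xi z s1 <= xi x1 s1.
  move=> zR yz; have := Thmax z y1 s1 zR y1R (ltW yz) s1I'.
  rewrite ler_pM2l ?expR_gt0 // ler_pM2r // (max_idPl (ltW Upos)).
  by apply: le_trans; rewrite le_max lexx.
have ymin z : enorm z < enorm x1 -> xi y1 s1 <= xi z s1.
  move=> zx; have zR : cball R z by apply: (le_trans (ltW zx)); exact: x1R.
  have := Thmax x1 z s1 x1R zR (ltW zx) s1I'.
  have Vge : 0 <= - xi y1 s1 by rewrite oppr_ge0 ltW.
  rewrite ler_pM2l ?expR_gt0 // ler_pM2l // [leRHS](max_idPl Vge).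
  by rewrite ge_max lerN2 => /andP[].
have y1i : oball R y1 by apply: lt_le_trans yx1' _; exact: x1R.
have oy : open (@oball K n (enorm x1)) by exact: open_oball.
have ox : open ([set z | enorm y1 < enorm z] `&` @oball K n R).
  apply: openI; last exact: open_oball.
  rewrite (_ : [set _ | _] = enorm @^-1` [set s | enorm y1 < s]) //.
  by apply: open_comp; [move=> x _; exact: continuous_enorm|exact: open_gt].
have [[Dy dy ly]|nmin] := int2 y1 s1 y1i s1I Vpos; last by exact: (nmin _ oy yx1').
have Dy0 := has_lap_min oy yx1' ymin ly.
have [x1i|x1b] := cballP x1R.
- have [Dx dx lx] := int1 x1 y1 s1 x1i s1I yx1' Vpos.
  have Dx0 : Dx <= 0.
    by apply: (has_lap_max ox _ _ lx) => // z [yz /ltW zR]; exact: xmax.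
  have posnear (g : K -> K) (s d : K) : is_derive s 1 g d -> 0 < g s ->
      exists2 r, 0 < r & forall h : K, `|h| < r -> 0 < g (s + h).
    move=> gd gs; have [r r0 Hr] := is_derive_remainder gd ltr01.
    have d0 : 0 < `|d| + 1 by rewrite ltr_wpDl.
    exists (Num.min r (g s / (`|d| + 1))); first by rewrite lt_min r0 divr_gt0.
    move=> h; rewrite lt_min ltr_pdivlMr // => /andP[/Hr + hd].
    rewrite ler_norml => /andP[H _].
    have : - (h * d) <= `|h| * `|d| by rewrite -normrM -normrN ler_norm.
    by nra.
  have [r r0 Hr] := posnear _ _ _ dx Upos.
  have dyN : is_derive s1 1 (fun s => - xi y1 s) (- Dy) by exact: is_deriveN.
  have Vpos3 : 0 < - xi y1 s1 by rewrite oppr_gt0.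
  have [r' r'0 Hr'] := posnear _ _ _ dyN Vpos3.
  have dexp : is_derive s1 1 (fun s : K => expR (- s)) (expR (- s1) * (-1)).
    have dn : is_derive s1 1 (fun s : K => - s) (-1).
      have := is_derive_quadratic 0 (-1) 0 s1.
      rewrite !mulr0 mul0r addr0 (_ : (fun _ => _) = fun s : K => - s) //.
      by apply/funext => s; ring.
    exact: (is_derive1_comp (is_derive_expR (- s1)) dn).
  have dprod := is_derive_mul dexp (is_derive_mul dx dyN).
  pose r2 := Num.min (Num.min r r') s1.
  have r20 : 0 < r2 by rewrite !lt_min r0 r'0.
  have := left_max_deriv_ge0 dprod r20.
  have H s : s1 - r2 < s <= s1 -> expR (- s) * (xi x1 s * - xi y1 s) <=
      expR (- s1) * (xi x1 s1 * - xi y1 s1).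
    move=> /andP[sr ss1].
    have hs : `|s - s1| < r2 by rewrite ler0_norm ?subr_le0 //; lra.
    move: hs; rewrite !lt_min => /andP[/andP[/Hr + /Hr'] + _].
    rewrite addrC subrK => Us Vs.
    have := Thmax x1 y1 s x1R y1R yx1.
    have : 0 <= s <= t.
      move: sr; rewrite ltrBlDr -ltrBlDl => sr; rewrite (le_trans ss1 s1t) andbT ltW //.
      have : r2 <= s1 by rewrite ge_min lexx orbT.
      lra.
    move=> -> /(_ isT).
    rewrite (max_idPl (ltW Us)) (max_idPl (ltW Vs)) (max_idPl (ltW Upos)).
    by rewrite (max_idPl _) // oppr_ge0 ltW.
  move=> /(_ H) H'.
  have e0 : 0 < expR (- s1) by exact: expR_gt0.
  move: H'; rewrite (_ : _ + _ = expR (- s1) *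
    (xi x1 s1 * xi y1 s1 - xi x1 s1 * Dy - xi y1 s1 * Dx)); last by rewrite /=; ring.
  rewrite pmulr_rge0 //; nra.
(* A negative ray derivative would make [xi] larger just inside the sphere, where by maximality it
   is at most [xi x1 s1]. The ray is kept outside the sphere through [y1]. *)
- have [d dxi d0] := bd x1 s1 x1b s1I Upos.
  have dN := ray_derivZ (-1) dxi.
  have r0 : 0 < 1 - enorm y1 / R.
    by rewrite subr_gt0 ltr_pdivrMr // mul1r; exact: y1i.
  suff : -1 * d <= 0 by lra.
  apply: (ray_deriv_le0 dN r0) => h /andP[h0 hr].
  have hy : enorm y1 < (1 - h) * R.
    by move: hr; rewrite ltrBrDr -ltrBrDl ltr_pdivrMr.
  have y10 := enorm_ge0 y1.
  have h1 : 0 <= 1 - h by rewrite -(pmulr_lge0 _ R0); lra.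
  rewrite !mulN1r lerN2; apply: xmax.
    by rewrite /cball /= enormZ ger0_norm // (x1b : enorm x1 = R); nra.
  by rewrite enormZ ger0_norm // (x1b : enorm x1 = R).
Qed.

(** The weak maximum principle on the shell |y| <= |z| <= R: [w] equals [w y < 0] on the inner
    sphere and is nonpositive on the outer one. *)
Lemma subharmonic_crossing R w x y : 0 < R -> (0 < n)%N ->
  {within cball R, continuous w} ->
  (forall x' y', cball R x' -> cball R y' -> enorm x' = enorm y' -> w x' = w y') ->
  (forall z, oball R z -> enorm y < enorm z -> exists2 L, has_lap w z L & 0 <= L) ->
  (forall z, bdball R z -> w z <= 0) ->
  cball R x -> cball R y -> enorm y <= enorm x -> w y < 0 -> w x <= 0.
Proof.
move=> R0 n0 cw rad lap bd xR yR yx wy; rewrite leNgt; apply/negP => wx.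
have R20 : 0 < R ^+ 2 by rewrite exprn_gt0.
(* Adding k |z|^2 makes [w] strictly subharmonic; this [k] keeps the perturbation below half of
   [w x], so the maximum stays off both spheres. *)
pose k := w x / (2 * R ^+ 2).
have k0 : 0 < k by rewrite divr_gt0 // mulr_gt0.
have kR : k * R ^+ 2 = w x / 2 by rewrite /k; field; rewrite gt_eqF.
pose g z := w z + k * sqn z.
pose Dom := @cball K n R `&` [set z | enorm y <= enorm z].
have cDom : compact Dom.
  apply: (subclosed_compact _ (@compact_cball K n R)); last by move=> z [].
  apply: closedI; first by apply: compact_closed; [exact: norm_hausdorff|exact: compact_cball].
  rewrite (_ : [set _ | _] = enorm @^-1` [set s | enorm y <= s]) //.
  by apply: closed_comp; [move=> z _; exact: continuous_enorm|exact: closed_ge].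
have cg : {within Dom, continuous g}.
  apply: within_continuousD; first by apply: within_continuousW cw _ => z [].
  apply: within_continuousM; apply: continuous_within; last exact: continuous_sqn.
  exact: cst_continuous.
have ne0 : Dom !=set0 by exists x.
have [z] := compact_EVT_max ne0 cDom cg.
rewrite inE => -[zR yz] zmax.
have gz : w x <= g z.
  apply: (@le_trans _ _ (g x)); first by rewrite lerDl mulr_ge0 ?sqn_ge0 // ltW.
  by apply: zmax; rewrite inE.
have kz : k * sqn z <= w x / 2 by rewrite -kR ler_pM2l // sqn_cball.
have yz' : enorm y < enorm z.
  rewrite lt_neqAle yz andbT; apply/eqP => /(rad _ _ yR zR) E.
  by move: gz; rewrite /g -E; lra.
have [zi|zb] := cballP zR; last by have := bd z zb; move: gz; rewrite /g; lra.
have [L lw L0] := lap z zi yz'.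
have lsq : has_lap (fun z => k * sqn z) z (k * (2 * n%:R * 1 + 4 * sqn z * 0)).
  apply: has_lapZ; apply: (has_lap_radial (c := fun s => s) (c1 := fun=> 1) ltr01).
have ox : open ([set z | enorm y < enorm z] `&` @oball K n R).
  apply: openI; last exact: open_oball.
  rewrite (_ : [set _ | _] = enorm @^-1` [set s | enorm y < s]) //.
  by apply: open_comp; [move=> x' _; exact: continuous_enorm|exact: open_gt].
have : L + k * (2 * n%:R * 1 + 4 * sqn z * 0) <= 0.
  apply: (has_lap_max ox _ _ (has_lapD lw lsq)) => // z' [yz1 zR1].
  by apply: zmax; rewrite inE; split; exact: ltW.
rewrite mulr0 addr0 mulr1 leNgt => /negP; apply.
by rewrite ltr_wpDl // mulr_gt0 // mulr_gt0 // ltr0n.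
Qed.

End SingleCrossing.

(** * The harmonic barrier *)

Section Harmonic.
Context {K : realType} {n : nat}.
Implicit Types (x y z : 'rV[K]_n) (w H : 'rV[K]_n -> K) (R C d s : K).

Lemma ray_deriv_local (A : set 'rV[K]_n) w w' x d : open A -> A x ->
  (forall y, A y -> w y = w' y) -> ray_deriv w x d -> ray_deriv w' x d.
Proof.
move=> oA Ax ww' wd eps eps0; have [r r0 Hr] := wd _ eps0.
have [r' r'0 Hr'] := line_nbhs (- x) oA Ax.
exists (Num.min r r'); first by rewrite lt_min r0.
move=> h /andP[h0]; rewrite lt_min => /andP[hr hr'].
have Ah : A ((1 - h) *: x).
  by have := Hr' h; rewrite gtr0_norm // scalerN -scaleNr scalerBl scale1r scaleNr; apply.
by rewrite -!ww' //; apply: Hr; rewrite h0.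
Qed.

(** Harmonicity is asked only where [H <= C], so that the singularity at the origin can be
    truncated. In the uses C exceeds A / exp(B^p), and then u >= 0 forces [H <= C] wherever u < A -
    exp(B^p) H. The fourth clause concerns points off the origin; the last one admits the kink of
    dimension one. The ray derivative [- R] is outward normal derivative -1. *)
Definition harmonic_barrier R C H := [/\ continuous H,
  forall x y, enorm x = enorm y -> H x = H y,
  forall x, bdball R x -> H x = 0 /\ ray_deriv H x (- R),
  forall y z, enorm y < enorm z -> H y <= C -> has_lap H z 0 &
  forall y, H y <= C -> has_lap H y 0 \/ peak H y].

(** In the variable S = |x|^2 the radial Laplace equation is n c' + 2 S c'' = 0, which c' = -
    S^(-n/2) solves. *)
Lemma has_lap_radial_harmonic (c : K -> K) x :
  (forall s, 0 < s -> is_derive s 1 c (-1 * s `^ (- (n%:R / 2)))) ->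
  0 < sqn x -> has_lap (fun y => c (sqn y)) x 0.
Proof.
move=> dc x0; set S := sqn x in x0 *; pose a : K := - (n%:R / 2).
have dc1 : is_derive S 1 (fun s => -1 * s `^ a) (-1 * (a * S `^ (a - 1))).
  by apply: is_derive_mull; exact: is_derive1_powR.
have near0 s : `|s - S| < S -> is_derive s 1 c (-1 * s `^ a).
  by rewrite ltr_norml => /andP[H _]; apply: dc; lra.
have := has_lap_radial (c := c) (c1 := fun s => -1 * s `^ a) x0 near0 dc1.
rewrite (_ : _ + _ = 0) // -/S.
have -> : S `^ a = S * S `^ (a - 1).
  rewrite -{2}(powRr1 (ltW x0)) -powRD; first by congr (_ `^ _); ring.
  by rewrite (gt_eqF x0) implybT.
by rewrite /a; field.
Qed.

Lemma harmonic_barrier_of_profile (c : K -> K) R C : 0 < R ->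
  (forall s, 0 < s -> is_derive s 1 c (-1 * s `^ (- (n%:R / 2)))) ->
  (forall M : K, exists2 s, 0 < s < R ^+ 2 & M < c s) ->
  exists H, harmonic_barrier R C H.
Proof.
move=> R0 dc cinf; have R20 : 0 < R ^+ 2 by rewrite exprn_gt0.
pose p := (R ^+ 2) `^ (- (n%:R / 2)).
have p0 : 0 < p by exact: powR_gt0.
(* Normalises the outward normal derivative on the sphere to -1. *)
pose k := (2 * R * p)^-1.
have k0 : 0 < k by rewrite invr_gt0 !mulr_gt0.
have kp : 2 * R * p * k = 1 by rewrite mulfV // gt_eqF // !mulr_gt0.
(* Freezing the profile below [s0] makes [H] constant and larger than [C] there, so the truncated
   region never meets [H <= C]. *)
have [s0 /andP[s00 s0R] Cs0] := cinf (C / k + c (R ^+ 2)).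
pose H x := k * (c (Num.max (sqn x) s0) + - c (R ^+ 2)).
have HC y : H y <= C -> s0 < sqn y.
  move=> HyC; rewrite ltNge; apply/negP => ys; move: HyC.
  by rewrite /H (max_idPr ys) mulrC -ler_pdivlMr // leNgt ltrBrDr Cs0.
have os : open [set y : 'rV[K]_n | s0 < sqn y].
  rewrite (_ : [set _ | _] = sqn @^-1` [set s | s0 < s]) //.
  by apply: open_comp; [move=> x _; exact: continuous_sqn|exact: open_gt].
have Heq y : s0 < sqn y -> k * (c (sqn y) + - c (R ^+ 2)) = H y.
  by move=> sy; rewrite /H (max_idPl (ltW sy)).
have lapH y : s0 < sqn y -> has_lap H y 0.
  move=> sy; apply: (has_lap_local (A := [set y | s0 < sqn y]) os sy Heq).
  have := has_lapZ k (has_lapD (has_lap_radial_harmonic dc (lt_trans s00 sy))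
    (has_lap_cst (- c (R ^+ 2)) y)).
  by rewrite addr0 mulr0.
exists H; split.
- move=> x.
  have cm : {for x, continuous (fun x : 'rV[K]_n => Num.max (sqn x) s0)}.
    rewrite (_ : (fun x : 'rV[K]_n => _) = fun x => Num.max (sqn x - s0) 0 + s0); last first.
      by apply/funext => y; rewrite addr_maxl subrK add0r.
    have cs : {for x, continuous (fun x : 'rV[K]_n => sqn x - s0)}.
      by apply: continuousB; [exact: continuous_sqn|exact: cst_continuous].
    apply: continuousD; last exact: cst_continuous.
    exact: (continuous_comp cs (@continuous_pos_part K _)).
  have m0 : 0 < Num.max (sqn x) s0 by rewrite lt_max s00 orbT.
  have cc : {for Num.max (sqn x) s0, continuous c}.
    by apply: differentiable_continuous; apply/derivable1_diffP; case: (dc _ m0).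
  have ch : {for x, continuous (fun x => c (Num.max (sqn x) s0) + - c (R ^+ 2))}.
    by apply: continuousD; [exact: (continuous_comp cm cc)|exact: cst_continuous].
  exact: (continuousM (@cst_continuous _ _ k x) ch).
- by move=> x y xy; rewrite /H -!sqr_enorm xy.
- move=> x xR; have xs : s0 < sqn x by rewrite (sqn_bdball xR).
  split; first by rewrite -Heq // (sqn_bdball xR) subrr mulr0.
  apply: (ray_deriv_local (A := [set y | s0 < sqn y]) os xs Heq).
  have dR := dc _ R20; rewrite -(sqn_bdball xR) in dR.
  have := ray_derivZ k (ray_derivD (ray_deriv_radial dR) (ray_deriv_cst (- c (R ^+ 2)) x)).
  rewrite (sqn_bdball xR) -/p (_ : k * _ = - R) //.
  have -> : k * (2 * R ^+ 2 * (-1 * p) + 0) = - R * (2 * R * p * k) by ring.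
  by rewrite kp mulr1.
- move=> y z yz /HC ys; apply: lapH; apply: lt_trans ys _.
  by rewrite -!sqr_enorm ltr_pXn2r ?nnegrE ?enorm_ge0.
- by move=> y /HC /lapH; left.
Qed.

(** The profiles are - ln S for n = 2 and S^(-m) / m with m = n/2 - 1 for n >= 3. For n = 1 the
    profile is bounded at 0 and cannot be truncated above [C]; there R - |x| is kept whole, with its
    peak at the origin. *)
Lemma exists_harmonic_barrier R C : (0 < n)%N -> 0 < R -> exists H, harmonic_barrier R C H.
Proof.
move=> n0 R0; have R20 : 0 < R ^+ 2 by rewrite exprn_gt0.
have half : 0 < R ^+ 2 / 2 < R ^+ 2 by rewrite divr_gt0 // ltr_pdivrMr // ltr_pMr // ltr1n.
have [n2|n2] := eqVneq n 2%N.
  apply: (@harmonic_barrier_of_profile (fun s => -1 * ln s)) => //.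
    move=> s s0; apply: is_derive_mull.
    apply: (is_derive_eq (is_derive1_ln s0)).
    by rewrite n2 divff // powR_inv1 // ltW.
  move=> M; exists (Num.min (R ^+ 2 / 2) (expR (- M - 1))).
    by rewrite lt_min gt_min expR_gt0; case/andP: half => -> ->.
  have m0 : 0 < Num.min (R ^+ 2 / 2) (expR (- M - 1)).
    by rewrite lt_min expR_gt0; case/andP: half => ->.
  have : ln (Num.min (R ^+ 2 / 2) (expR (- M - 1))) <= - M - 1.
    by rewrite -[leRHS]expRK ler_ln ?posrE ?expR_gt0 // ge_min lexx orbT.
  lra.
have [n1|n1] := eqVneq n 1%N.
  have dc (s : K) : 0 < s -> is_derive s 1 (fun s => -2 * s `^ 2^-1) (-1 * s `^ (- (n%:R / 2))).
    move=> s0; apply: (is_derive_eq (is_derive_mull (-2) (is_derive1_powR 2^-1 s0))).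
    rewrite n1 mulrA (_ : -2 * 2^-1 = -1); last by field.
    by congr (_ * _ `^ _); field.
  have lapH y : 0 < sqn y -> has_lap (fun x => R - enorm x) y 0.
    move=> y0.
    have := has_lapD (has_lap_cst R y) (has_lapZ (1 / 2) (has_lap_radial_harmonic dc y0)).
    rewrite mulr0 addr0 (_ : (fun _ => _) = fun x => R - enorm x) //.
    by apply/funext => x; rewrite powR12_sqrt ?sqn_ge0 // -/(enorm x); field.
  exists (fun x => R - enorm x); split.
  - by move=> x; apply: continuousB; [exact: cst_continuous|exact: continuous_enorm].
  - by move=> x y ->.
  - move=> x xR; split; first by rewrite (xR : enorm x = R) subrr.
    move=> eps eps0; exists 1 => // h /andP[h0 h1].
    rewrite enormZ (xR : enorm x = R) [`|1 - h|]ger0_norm; last by lra.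
    by rewrite (_ : _ - _ = 0) ?normr0 ?mulr_ge0 ?(ltW eps0) ?(ltW h0) //; ring.
  - move=> y z yz _; apply: lapH; rewrite -sqr_enorm exprn_gt0 //; exact: le_lt_trans (enorm_ge0 y) yz.
  - move=> y _; have [y0|y0] := eqVneq (sqn y) 0; last first.
      by left; apply: lapH; rewrite lt_neqAle eq_sym y0 sqn_ge0.
    have {}y0 : y = 0 by apply: enorm_eq0; rewrite /enorm -/(sqn y) y0 sqrtr0.
    right; exists (Ordinal n0), 1; split => // s; rewrite y0 add0r enormZ mul1r.
    have -> : enorm (0 : 'rV[K]_n) = 0.
      by have := enormZ 0 (0 : 'rV[K]_n); rewrite scale0r normr0 mul0r.
    by rewrite enorm_delta mulr1 subr0.
have n3 : (2 < n)%N by move: n0 n1 n2; case: (n) => [|[|[|]]].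
pose m : K := n%:R / 2 - 1.
have m2 : 1 / 2 <= m.
  by have : 3%:R <= n%:R :> K by [rewrite ler_nat]; rewrite /m; lra.
have m0 : 0 < m by lra.
apply: (@harmonic_barrier_of_profile (fun s => m^-1 * s `^ (- m))) => //.
  move=> s s0; apply: (is_derive_eq (is_derive_mull m^-1 (is_derive1_powR (- m) s0))).
  rewrite (_ : - m - 1 = - (n%:R / 2)); last by rewrite /m; ring.
  by field; rewrite gt_eqF.
(* From ln s <= -X and m >= 1/2 follows s^(-m) >= 1 + X / 2, and dividing by m gives 1/m + |M| >
   M. *)
move=> M; pose X := 2 * m * `|M|.
have X0 : 0 <= X by rewrite !mulr_ge0 // ltW.
pose s := Num.min (R ^+ 2 / 2) (expR (- X)).
have s0 : 0 < s by rewrite lt_min expR_gt0; case/andP: half => ->.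
exists s; first by rewrite s0 /= gt_min; case/andP: half => _ ->.
have lns : ln s <= - X.
  by rewrite -[leRHS]expRK ler_ln ?posrE ?expR_gt0 // ge_min lexx orbT.
have H : 1 + X / 2 <= s `^ (- m).
  rewrite /powR gt_eqF //; apply: (le_trans _ (expR_ge1Dx _)).
  rewrite lerD2l mulNr -mulrN; nra.
have : m^-1 * (1 + X / 2) <= m^-1 * s `^ (- m) by rewrite ler_pM2l // invr_gt0.
apply: lt_le_trans; rewrite (_ : _ * _ = m^-1 + `|M|); last by rewrite /X; field; rewrite gt_eqF.
by have := ler_norm M; have : 0 < m^-1 by [rewrite invr_gt0]; lra.
Qed.

End Harmonic.

(** * Directional derivatives and rotations *)

Section Directional.
Context {K : realType} {n : nat}.
Implicit Types (x y z h : 'rV[K]_n) (w : 'rV[K]_n -> K) (i : 'I_n) (R C d s : K).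

Local Notation e i := (delta_mx ord0 i : 'rV[K]_n).

Lemma mean_value_bound (g g1 : K -> K) (c d eps : K) :
  (forall s : K, `|s| <= `|c| -> is_derive s 1 g (g1 s) /\ `|g1 s - d| <= eps) ->
  `|g c - g 0 - c * d| <= eps * `|c|.
Proof.
move=> Hg; have [->|c0] := eqVneq c 0.
  by rewrite subrr mul0r subr0 !normr0 mulr0.
have cts a b : (forall s : K, a <= s <= b -> `|s| <= `|c|) -> {within `[a, b], continuous g}.
  move=> ab; apply: derivable_within_continuous => s; rewrite in_itv /= => /ab /Hg[].
  by case.
have drv a b : (forall s : K, a <= s <= b -> `|s| <= `|c|) ->
    forall s : K, s \in `]a, b[ -> is_derive s 1 g (g1 s).
  move=> ab s; rewrite in_itv /= => /andP[/ltW as_ /ltW sb].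
  by have [] := Hg s; rewrite ?ab // as_.
have [c1|c1] := ltrP 0 c.
  have ab (s : K) : 0 <= s <= c -> `|s| <= `|c|.
    by move=> /andP[s0 sc]; rewrite !ger0_norm // ltW.
  have [s sI E] := MVT c1 (drv _ _ ab) (cts _ _ ab).
  have [_ H] : is_derive s 1 g (g1 s) /\ `|g1 s - d| <= eps.
    by apply: Hg; apply: ab; move: sI; rewrite in_itv /= => /andP[/ltW -> /ltW ->].
  rewrite E subr0 (_ : _ - _ = (g1 s - d) * c); last by ring.
  by rewrite normrM ler_wpM2r.
have {}c1 : c < 0 by rewrite lt_neqAle c0.
have ab (s : K) : c <= s <= 0 -> `|s| <= `|c|.
  by move=> /andP[cs s0]; rewrite !ler0_norm ?lerN2 // ltW.
have [s sI E] := MVT c1 (drv _ _ ab) (cts _ _ ab).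
have [_ H] : is_derive s 1 g (g1 s) /\ `|g1 s - d| <= eps.
  by apply: Hg; apply: ab; move: sI; rewrite in_itv /= => /andP[/ltW -> /ltW ->].
rewrite -[g c](subKr (g 0)) E (_ : _ - _ = (g1 s - d) * c); last by ring.
by rewrite normrM ler_wpM2r.
Qed.

Lemma is_derive_slice w z i s : has_partial i w (z + s *: e i) ->
  is_derive s 1 (fun a => w (z + a *: e i)) (partial i w (z + s *: e i)).
Proof.
rewrite /has_partial /partial => hw.
have E : (fun h : K => h^-1 *: (((fun a => w (z + a *: e i)) \o shift s) (h *: 1) -
    w (z + s *: e i))) =
    (fun h : K => h^-1 *: ((w \o shift (z + s *: e i)) (h *: e i) - w (z + s *: e i))).
  apply/funext => h /=; congr (_ *: (w _ - _)).
  by rewrite scalerDl [h *: 1]mulr1 addrCA addrA addrC addrA.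
by split; [rewrite /derivable E|rewrite /derive E].
Qed.

Lemma is_derive_line w z h s d :
  is_derive (0 : K) 1 (fun a : K => w (z + s *: h + a *: h)) d ->
  is_derive s 1 (fun a : K => w (z + a *: h)) d.
Proof.
move=> H; apply: remainder_is_derive => eps eps0.
have [r r0 Hr] := is_derive_remainder H eps0; exists r => // a /Hr.
by rewrite add0r scale0r addr0 scalerDl addrA.
Qed.

Lemma norm_delta_le1 i : `|e i| <= 1.
Proof.
rewrite /Num.Def.normr /= mx_normrE; apply/bigmax_leP; split => // -[a j] _ /=.
by rewrite mxE; case: (_ && _); rewrite ?normr1 ?normr0.
Qed.

(* Change the coordinates one at a time and apply the mean value theorem. *)
Lemma is_derive_direction R w x h : oball R x ->
  (forall i y, oball R y -> has_partial i w y) ->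
  (forall i, {for x, continuous (partial i w)}) ->
  is_derive (0 : K) 1 (fun s : K => w (x + s *: h)) (\sum_i h ord0 i * partial i w x).
Proof.
move=> xR hw cw.
suff H (r : seq 'I_n) : is_derive (0 : K) 1
    (fun s : K => w (x + s *: (\sum_(i <- r) h ord0 i *: e i)))
    (\sum_(i <- r) h ord0 i * partial i w x).
  by rewrite [h in X in is_derive _ _ X](row_sum_delta h); exact: H.
elim: r => [|i r IH].
  rewrite [X in is_derive _ _ _ X]big_nil (_ : (fun _ => _) = fun=> w x).
    exact: is_derive_cst.
  by apply/funext => s; rewrite big_nil scaler0 addr0.
set H := \sum_(j <- r) _ *: _ in IH.
apply: remainder_is_derive => eps eps0.
have eps2 : 0 < eps / 2 by rewrite divr_gt0.
pose M := `|h ord0 i| + 1.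
have M0 : 0 < M by rewrite ltr_wpDl.
have [r1 r10 Hr1] := is_derive_remainder IH eps2.
have epsM : 0 < eps / 2 / M by rewrite !divr_gt0.
have near1 : nbhs x (partial i w @^-1` ball (partial i w x) (eps / 2 / M)).
  exact: (cw i _ (@nbhsx_ballx _ _ (partial i w x) _ epsM)).
have near2 : nbhs x (@oball K n R) by apply: open_nbhs_nbhs; split => //; exact: open_oball.
have near12 : nbhs x ((partial i w @^-1` ball (partial i w x) (eps / 2 / M)) `&` oball R).
  exact: filterI.
move/nbhs_ballP : near12 => [rho /= rho0 Hrho].
pose N := `|H| + M.
have N0 : 0 < N by rewrite ltr_wpDl.
exists (Num.min r1 (rho / N)); first by rewrite lt_min r10 divr_gt0.
move=> s; rewrite lt_min ltr_pdivlMr // => /andP[sr1 srho].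
rewrite add0r !big_cons -/H scale0r addr0.
have := Hr1 s sr1; rewrite add0r !scale0r !addr0 => H1.
have H2 : `|w (x + s *: H + (s * h ord0 i) *: e i) - w (x + s *: H + 0 *: e i) -
    (s * h ord0 i) * partial i w x| <= eps / 2 / M * `|s * h ord0 i|.
  apply: (mean_value_bound (g := fun a => w (x + s *: H + a *: e i))
     (g1 := fun a => partial i w (x + s *: H + a *: e i))) => a asmall.
  have /Hrho[/= Hb Ho] : ball x rho (x + s *: H + a *: e i).
    rewrite -ball_normE /= -addrA opprD addrA subrr sub0r normrN.
    apply: le_lt_trans srho; apply: le_trans (ler_normD _ _) _.
    rewrite !normrZ /N mulrDr lerD2l; have := norm_delta_le1 i.
    move: asmall; rewrite normrM => a1 e1; have := normr_ge0 a; have := normr_ge0 s.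
    have := normr_ge0 (e i); rewrite /M; nra.
  split; first by apply: is_derive_slice; exact: hw.
  by move: Hb; rewrite -ball_normE /= distrC => /ltW.
have -> : w (x + s *: (h ord0 i *: e i + H)) = w (x + s *: H + (s * h ord0 i) *: e i).
  by rewrite scalerDr scalerA [_ + s *: H]addrC addrA.
move: H2; rewrite scale0r addr0 => H2.
rewrite (_ : _ - _ = (w (x + s *: H + (s * h ord0 i) *: e i) - w (x + s *: H) -
    (s * h ord0 i) * partial i w x) + (w (x + s *: H) - w x -
    s * \sum_(j <- r) h ord0 j * partial j w x)); last by ring.
apply: le_trans (ler_normD _ _) _.
have H3 : eps / 2 / M * `|s * h ord0 i| <= eps / 2 * `|s|.
  rewrite normrM mulrCA [leRHS]mulrC ler_wpM2l //.
  rewrite mulrAC ler_pdivrMr // ler_pM2l ?divr_gt0 // /M lerDl //.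
apply: le_trans (lerD H2 H1) _; lra.
Qed.

Lemma has_lap_laplacian R w x : oball R x ->
  (forall i y, oball R y -> has_partial i w y) ->
  (forall i, has_partial i (partial i w) x) ->
  has_lap w x (laplacian w x).
Proof.
move=> xR h1 h2; exists (fun i => partial i (partial i w) x); split => // i.
have [r r0 Hr] := line_nbhs (e i) (@open_oball K n R) xR.
exists (fun s => partial i w (x + s *: e i)), r; split; first exact: r0.
  by move=> s /Hr /(h1 i) /is_derive_slice.
have xE : x = x + 0 *: e i by rewrite scale0r addr0.
by rewrite [in X in is_derive _ _ _ X]xE; apply: is_derive_slice; rewrite -xE.
Qed.

(** The axes become the rows of [M]. The second derivative along row [i] is the sum of M_ij M_ik d_k
    d_j w, and summing over [i] leaves only j = k because the columns of [M] are orthonormal. *)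
Lemma has_lap_orthogonal R w x (M : 'M[K]_n) : M *m M^T = 1%:M -> oball R (x *m M) ->
  (forall i y, oball R y -> has_partial i w y) ->
  (forall i y, oball R y -> {for y, continuous (partial i w)}) ->
  (forall i j y, oball R y -> has_partial j (partial i w) y) ->
  (forall i j y, oball R y -> {for y, continuous (partial j (partial i w))}) ->
  has_lap (fun y => w (y *m M)) x (laplacian w (x *m M)).
Proof.
move=> MM xR h1 c1 h2 c2; set z := x *m M in xR *.
have slice i s : (x + s *: e i) *m M = z + s *: row i M.
  by rewrite mulmxDl -scalemxAl -rowE.
exists (fun i => \sum_j M i j * \sum_k M i k * partial k (partial j w) z); split.
- move=> i; have [r r0 Hr] := line_nbhs (row i M) (@open_oball K n R) xR.
  exists (fun s => \sum_j M i j * partial j w (z + s *: row i M)), r; split => //.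
  + move=> s /Hr zs; rewrite (_ : (fun _ => _) = fun a => w (z + a *: row i M)); last first.
      by apply/funext => a; rewrite slice.
    apply: is_derive_line.
    have := is_derive_direction (row i M) zs h1 (fun j => c1 j _ zs).
    by congr is_derive; apply: eq_bigr => j _; rewrite mxE.
  + suff H (r' : seq 'I_n) : is_derive (0 : K) 1
      (fun s => \sum_(j <- r') M i j * partial j w (z + s *: row i M))
      (\sum_(j <- r') M i j * \sum_k M i k * partial k (partial j w) z) by exact: H.
    elim: r' => [|j r' IH].
      rewrite [X in is_derive _ _ _ X]big_nil (_ : (fun _ => _) = fun=> 0).
        exact: is_derive_cst.
      by apply/funext => s; rewrite big_nil.
    rewrite [X in is_derive _ _ _ X]big_cons.
    rewrite (_ : (fun _ => _) = fun s => M i j * partial j w (z + s *: row i M) +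
      \sum_(j <- r') M i j * partial j w (z + s *: row i M)); last first.
      by apply/funext => s; rewrite big_cons.
    apply: is_deriveD; apply: is_derive_mull.
    have := is_derive_direction (row i M) xR (h2 j) (fun k => c2 j k _ xR).
    by congr is_derive; apply: eq_bigr => k _; rewrite mxE.
- have MM' j k : \sum_i M i j * M i k = (j == k)%:R.
    have := congr1 (fun A : 'M[K]_n => A j k) (mulmx1C MM); rewrite !mxE => <-.
    by apply: eq_bigr => i _; rewrite mxE.
  rewrite exchange_big /= /laplacian; apply: eq_bigr => j _.
  transitivity (\sum_k (\sum_i M i j * M i k) * partial k (partial j w) z).
    rewrite (bigD1 j) //= MM' eqxx mul1r big1 ?addr0 // => k kj.
    by rewrite MM' eq_sym (negbTE kj) mul0r.
  transitivity (\sum_k \sum_i M i j * M i k * partial k (partial j w) z).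
    by apply: eq_bigr => k _; rewrite mulr_suml.
  rewrite exchange_big /=; apply: eq_bigr => i _; rewrite mulr_sumr.
  by apply: eq_bigr => k _; rewrite mulrA.
Qed.

Lemma enorm_orthogonal x (M : 'M[K]_n) : M *m M^T = 1%:M -> enorm (x *m M) = enorm x.
Proof.
move=> MM; have sqnE y : sqn y = (y *m y^T) ord0 ord0.
  by rewrite mxE; apply: eq_bigr => i _; rewrite mxE expr2.
rewrite /enorm -!/(sqn _) !sqnE trmx_mul mulmxA -[x *m M *m _]mulmxA MM.
by rewrite mulmx1.
Qed.

(** The reflection in the hyperplane orthogonal to [m = x - y]. From |x| = |y| the inner product of
    [x] with [m] is |m|^2 / 2, so [x] is sent to [y]. *)
Lemma exists_orthogonal x y : enorm x = enorm y ->
  exists2 M : 'M[K]_n, M *m M^T = 1%:M & x *m M = y.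
Proof.
move=> xy; have [->|xy'] := eqVneq x y.
  by exists 1%:M; rewrite ?trmx1 mulmx1.
have sq a : a *m a^T = (sqn a)%:M :> 'M[K]_1.
  apply/rowP => i; rewrite ord1 !mxE eqxx mulr1n.
  by apply: eq_bigr => j _; rewrite mxE expr2.
have sxy : sqn x = sqn y by rewrite -!sqr_enorm xy.
pose m := x - y; pose a := sqn m.
have a0 : a != 0.
  apply/eqP => a0; have : m = 0 by apply: enorm_eq0; rewrite /enorm -/(sqn m) -/a a0 sqrtr0.
  by move/eqP; rewrite subr_eq0 (negbTE xy').
pose P := m^T *m m : 'M[K]_n.
have PT : P^T = P by rewrite /P trmx_mul trmxK.
have PP : P *m P = a *: P.
  by rewrite /P mulmxA -[m^T *m m *m _]mulmxA sq mul_mx_scalar -scalemxAl.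
have xm : x *m m^T = (a / 2)%:M.
  apply/rowP => i; rewrite ord1 !mxE eqxx mulr1n /a /sqn.
  have E : \sum_j (x ord0 j ^+ 2 - y ord0 j ^+ 2) = 0.
    by rewrite sumrB -!/(sqn _) sxy subrr.
  rewrite -[RHS]addr0 -[X in _ + X](mul0r (2^-1 : K)) -[X in _ + X * _]E.
  rewrite !mulr_suml -big_split; apply: eq_bigr => j _ /=.
  by rewrite !mxE; field.
have xP : x *m P = (a / 2) *: m by rewrite /P mulmxA xm mul_scalar_mx.
clearbody P; exists (1%:M - (2 / a) *: P).
  have -> : (1%:M - (2 / a) *: P)^T = 1%:M - (2 / a) *: P.
    by apply/matrixP => i j; rewrite !mxE eq_sym -{1}PT mxE.
  rewrite mulmxBl mul1mx mulmxBr mulmx1 -scalemxAl -scalemxAr PP !scalerA.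
  rewrite (_ : 2 / a * (2 / a) * a = 2 / a + 2 / a); last by field.
  by rewrite scalerDl opprB addrK subrK.
rewrite mulmxBr mulmx1 -scalemxAr xP scalerA.
rewrite (_ : 2 / a * (a / 2) = 1); last by field.
by rewrite scale1r /m opprB addrC subrK.
Qed.

End Directional.

(** * Caloric functions with boundary flux *)

Section Flux.
Context {K : realType} {n : nat}.
Implicit Types (x y : 'rV[K]_n) (R T p s t d : K) (u : 'rV[K]_n -> K -> K)
  (a : 'rV[K]_n -> K -> K).

Lemma slice_continuous R T u x t : {within oball R `*` `]0, T[, continuous (uncurried u)} ->
  oball R x -> 0 < t < T -> {for x, continuous (fun y => u y t)}.
Proof.
move=> cu xR tT; suff : {within oball R, continuous (fun y => u y t)}.
  rewrite continuous_open_subspace; last exact: open_oball.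
  by move=> /(_ x); rewrite inE; apply.
apply: (within_continuous_comp (g := fun y => (y, t)) cu); last first.
  by move=> y yR; split => //=; rewrite in_itv.
by apply: continuous_pair; [move=> y; exact: cvg_id|exact: cst_continuous].
Qed.

Lemma continuous_ray x : continuous (fun h : K => (1 - h) *: x).
Proof.
move=> h; apply: cvgZr_tmp.
by apply: cvgB; [exact: cvg_cst|exact: cvg_id].
Qed.

Lemma ray_oball R x h : bdball R x -> 0 < R -> 0 < h < 1 -> oball R ((1 - h) *: x).
Proof.
move=> xR R0 /andP[h0 h1]; rewrite /oball /= enormZ gtr0_norm ?subr_gt0 //.
by rewrite (xR : enorm x = R) gtr_pMl // ltrBlDr ltrDl.
Qed.

Lemma ray_cball R x h : bdball R x -> 0 < R -> 0 <= h <= 1 -> cball R ((1 - h) *: x).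
Proof.
move=> xR R0 /andP[h0 h1]; rewrite /cball /= enormZ ger0_norm ?subr_ge0 //.
by rewrite (xR : enorm x = R) ger_pMl // lerBlDr lerDl.
Qed.

(** The boundary condition is about a continuous extension of the gradient; the mean value theorem
    along the ray turns it into a limit of difference quotients at the sphere. The factor [R] is the
    speed of the ray. *)
Lemma ray_deriv_gradient R T u G x t : 0 < R ->
  {within cball R `*` `[0, T[, continuous (uncurried u)} -> C21 R T u ->
  gradient_upto_boundary R T u G -> bdball R x -> 0 < t < T ->
  ray_deriv (u^~ t) x (R * normal_deriv R G x t).
Proof.
move=> R0 cu [h1 [_ [c1 _]]] hG xR tT.
have t0T : 0 <= t < T by case/andP: tT => /ltW -> ->.
have cur : {within `[0, 1], continuous (fun h : K => u ((1 - h) *: x) t)}.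
  apply: (within_continuous_comp (g := fun h : K => ((1 - h) *: x, t)) cu); last first.
    move=> h; rewrite /= in_itv /= => h01; split => /=; first exact: ray_cball.
    by rewrite in_itv.
  by apply: continuous_pair; [exact: continuous_ray|exact: cst_continuous].
pose F (h : K) := \sum_i x ord0 i * G i ((1 - h) *: x) t.
have cF : {within `[0, 1], continuous F}.
  rewrite /F; elim: (index_enum _) => [|i r IH].
    rewrite (_ : (fun _ => _) = fun=> 0); first by apply: continuous_within; exact: cst_continuous.
    by apply/funext => h; rewrite big_nil.
  rewrite (_ : (fun _ => _) = fun h : K => x ord0 i * G i ((1 - h) *: x) t +
      \sum_(j <- r) x ord0 j * G j ((1 - h) *: x) t); last first.
    by apply/funext => h; rewrite big_cons.
  apply: within_continuousD IH; apply: within_continuousM.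
    by apply: continuous_within; exact: cst_continuous.
  apply: (within_continuous_comp (g := fun h : K => ((1 - h) *: x, t)) (hG i).1); last first.
    move=> h; rewrite /= in_itv /= => h01; split => /=; first exact: ray_cball.
    by rewrite in_itv.
  by apply: continuous_pair; [exact: continuous_ray|exact: cst_continuous].
have F0 : F 0 = R * normal_deriv R G x t.
  rewrite /F /normal_deriv mulr_sumr; apply: eq_bigr => i _.
  by rewrite subr0 scale1r; field; rewrite gt_eqF.
have dr (h : K) : 0 < h < 1 -> is_derive h 1 (fun h : K => u ((1 - h) *: x) t) (- F h).
  move=> h01; have hR := ray_oball xR R0 h01.
  have := is_derive_direction (w := fun y => u y t) (- x) hR.
  move=> /(_ (fun i y yR => (h1 y t yR tT).2.1 i)).
  move=> /(_ (fun i => slice_continuous (c1 i) hR tT)) H.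
  have E : \sum_i (- x) ord0 i * partial i (u^~ t) ((1 - h) *: x) = - F h.
    rewrite /F -sumrN; apply: eq_bigr => i _.
    by rewrite mxE mulNr (hG i).2.
  rewrite E {E} in H.
  rewrite (_ : (fun _ => _) = fun k : K => u (x + k *: (- x)) t); last first.
    by apply/funext => k; rewrite scalerBl scale1r scalerN.
  apply: (is_derive_line (w := u^~ t)).
  by move: H; rewrite scalerBl scale1r scalerN.
rewrite -F0 => eps eps0.
have [r r0 Hr] : exists2 r : K, 0 < r & forall h, 0 <= h <= 1 -> h < r -> `|F h - F 0| <= eps.
  have I0 : `[0, 1]%classic (0 : K) by rewrite /= in_itv /= lexx ler01.
  move/subspace_continuousP : cF => /(_ 0 I0) /cvgrPdist_le /(_ eps eps0).
  rewrite /= /within /= => /nbhs_ballP[r /= r0 Hr]; exists r => // h h01 hr.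
  rewrite distrC; apply: Hr; last by rewrite in_itv.
  by rewrite /ball /= sub0r normrN ger0_norm //; case/andP: h01.
exists (Num.min r 1); first by rewrite lt_min r0 ltr01.
move=> h /andP[h0]; rewrite lt_min => /andP[hr h1'].
have drh (k : K) : k \in `]0, h[ -> is_derive k 1 (fun h : K => u ((1 - h) *: x) t) (- F k).
  rewrite in_itv /= => /andP[k0 kh]; apply: dr.
  by rewrite k0 (lt_trans kh).
have ch : {within `[0, h], continuous (fun h : K => u ((1 - h) *: x) t)}.
  apply: within_continuousW cur _ => k; rewrite /= !in_itv /= => /andP[-> kh].
  by rewrite (le_trans kh) // ltW.
have [c] := MVT h0 drh ch; rewrite in_itv /= => /andP[c0 ch'].
rewrite !subr0 scale1r => E.
rewrite -[u x t - _]opprB E (_ : _ - _ = h * (F c - F 0)); last by ring.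
rewrite normrM gtr0_norm // mulrC ler_wpM2r ?(ltW h0) //.
by apply: Hr; [rewrite !ltW // (lt_trans ch')|exact: lt_trans ch' hr].
Qed.

(** What the comparison arguments use of one equation of the system. Taking the flux [a] as given
    decouples the two equations. *)
Definition heat_flux R T u a := [/\
  {within cball R `*` `[0, T[, continuous (uncurried u)},
  forall x t, oball R x -> 0 < t < T ->
    exists2 D, is_derive t 1 (u x) D & has_lap (u^~ t) x D &
  forall x t, bdball R x -> 0 < t < T -> ray_deriv (u^~ t) x (R * a x t)].

Lemma heat_flux_C21 R T u G a : 0 < R ->
  {within cball R `*` `[0, T[, continuous (uncurried u)} -> C21 R T u ->
  (forall x t, oball R x -> 0 < t < T -> dt u x t = laplacian (u^~ t) x) ->
  gradient_upto_boundary R T u G ->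
  (forall x t, bdball R x -> 0 < t < T -> normal_deriv R G x t = a x t) ->
  heat_flux R T u a.
Proof.
move=> R0 cu u21 heq hG hn; split => //.
- move=> x t xR tT; exists (dt u x t).
    by rewrite /dt derive1E; apply: derivableP; case: u21 => /(_ x t xR tT)[].
  rewrite heq //; apply: (has_lap_laplacian xR).
    by move=> i y yR; case: u21 => /(_ y t yR tT)[_ []].
  by move=> i; case: u21 => /(_ x t xR tT)[_ [_ h2]] _; exact: (h2 i i).
- by move=> x t xR tT; rewrite -hn //; exact: (ray_deriv_gradient R0 cu u21 hG).
Qed.

Lemma continuous_mulmxr (M : 'M[K]_n) : continuous (fun y => y *m M).
Proof.
rewrite (_ : (fun _ => _) = fun y => \sum_i y ord0 i *: row i M).
  apply: continuous_sum => i y.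
  have cy : (z : 'rV[K]_n) ord0 i @[z --> y] --> y ord0 i by exact: coord_continuous.
  exact: (cvgZr_tmp cy).
by apply/funext => y; rewrite mulmx_sum_row.
Qed.

Lemma heat_flux_orthogonal R T u G a (M : 'M[K]_n) : 0 < R -> M *m M^T = 1%:M ->
  {within cball R `*` `[0, T[, continuous (uncurried u)} -> C21 R T u ->
  (forall x t, oball R x -> 0 < t < T -> dt u x t = laplacian (u^~ t) x) ->
  gradient_upto_boundary R T u G ->
  (forall x t, bdball R x -> 0 < t < T -> normal_deriv R G x t = a x t) ->
  heat_flux R T (fun x t => u (x *m M) t) (fun x t => a (x *m M) t).
Proof.
move=> R0 MM cu u21 heq hG hn.
have [_ _ hb] := heat_flux_C21 R0 cu u21 heq hG hn.
have eM x : enorm (x *m M) = enorm x by exact: enorm_orthogonal.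
split.
- apply: (within_continuous_comp (g := fun z : 'rV[K]_n * K => (z.1 *m M, z.2)) cu).
    apply: continuous_pair; last by move=> z; exact: cvg_snd.
    move=> z; apply: (@continuous_comp _ _ _ fst (fun y : 'rV[K]_n => y *m M)).
      exact: cvg_fst.
    exact: continuous_mulmxr.
  by move=> [y t] [/= yR tT]; split => //=; rewrite /cball /= eM.
- move=> x t xR tT.
  have xMR : oball R (x *m M) by rewrite /oball /= eM.
  have [h1 [_ [c1 c2]]] := u21; exists (dt u (x *m M) t).
    by rewrite /dt derive1E; apply: derivableP; case: (h1 _ t xMR tT).
  rewrite heq //; apply: (has_lap_orthogonal (w := u^~ t) MM xMR).
  + by move=> i y yR; case: (h1 y t yR tT) => _ [].
  + by move=> i y yR; exact: slice_continuous (c1 i) yR tT.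
  + by move=> i j y yR; case: (h1 y t yR tT) => _ [_]; exact.
  + by move=> i j y yR; exact: slice_continuous (c2 i j) yR tT.
- move=> x t xR tT.
  have xMR : bdball R (x *m M) by rewrite /bdball /= eM.
  move=> eps eps0; have [r r0 Hr] := hb _ t xMR tT eps eps0.
  by exists r => // h /Hr; rewrite -scalemxAl.
Qed.

Lemma within_segment_bounded R T t u : t < T ->
  {within cball R `*` `[0, T[, continuous (uncurried u)} ->
  exists C, forall x s, cball R x -> 0 <= s <= t -> u x s <= C.
Proof.
move=> tT cu.
have [e|ne] := pselect ((cball R `*` `[0, t] : set ('rV[K]_n * K)) !=set0); last first.
  exists 0 => x s xR st; exfalso; apply: ne; exists (x, s).
  by split => //=; rewrite in_itv.
have cpt := compact_setX (@compact_cball K n R) (@segment_compact K 0 t).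
have [|z _ Hz] := compact_EVT_max e cpt (f := uncurried u).
  apply: within_continuousW cu _ => -[x s] [/= xR]; rewrite in_itv /= => /andP[s0 st].
  by split => //=; rewrite in_itv /= s0 (le_lt_trans st).
exists (uncurried u z) => x s xR st; apply: (Hz (x, s)).
by rewrite inE; split => //=; rewrite in_itv.
Qed.

(** * Monotonicity and local Lipschitz bounds of the exponential flux *)

Lemma exp_power_mono p : 0 <= p -> forall s t, 0 <= s -> s <= t -> expR (s `^ p) <= expR (t `^ p).
Proof.
move=> p0 s t s0 st; rewrite ler_expR ge0_ler_powR // nnegrE //.
exact: le_trans st.
Qed.

(** A one-sided bound: by monotonicity the difference can be negative only for s < t, where it is
    controlled by the derivative, itself largest at [C]. *)
Lemma exp_power_lipschitz p C : 1 < p -> exists2 L, 0 <= L &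
  forall s t, 0 <= s <= C -> 0 <= t <= C ->
    L * Num.min (s - t) 0 <= expR (s `^ p) - expR (t `^ p).
Proof.
move=> p1; have p0 : 0 < p by exact: lt_trans p1.
pose L := p * C `^ (p - 1) * expR (C `^ p).
have L0 : 0 <= L by rewrite !mulr_ge0 ?powR_ge0 ?expR_ge0 // ltW.
exists L => // s t /andP[s0 sC] /andP[t0 tC].
have [ts|st] := lerP t s.
  rewrite (min_idPr _) ?subr_ge0 // mulr0 subr_ge0.
  by apply: exp_power_mono => //; exact: ltW.
rewrite (min_idPl _); last by rewrite subr_le0 ltW.
have dF (z : K) : 0 < z ->
    is_derive z 1 (fun z => expR (z `^ p)) (expR (z `^ p) * (p * z `^ (p - 1))).
  move=> z0; have d1 := is_derive1_powR p z0.
  exact: (is_derive1_comp (g := (@powR K)^~ p) (is_derive_expR (z `^ p)) d1).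
have C0 : 0 <= C by exact: le_trans tC.
(* The power is differentiated only at positive arguments, so s = 0 is done by hand with e^y - 1 <=
   y e^y and t^p = t t^(p-1). *)
have [s00|s00] := eqVneq s 0.
  rewrite s00 powR0 ?gt_eqF // expR0 sub0r mulrN -lerN2 opprB opprK.
  have tp0 : 0 <= t `^ p by exact: powR_ge0.
  apply: (@le_trans _ _ (t `^ p * expR (t `^ p))).
    have e0 := expR_gt0 (t `^ p).
    have e1 : expR (- (t `^ p)) * expR (t `^ p) = 1 by rewrite -expRD addNr expR0.
    have := ler_wpM2r (ltW e0) (expR_ge1Dx (- (t `^ p))).
    by rewrite e1 mulrDl mul1r mulNr; lra.
  have H := exp_power_mono (ltW p0) t0 tC.
  have H2 : t `^ (p - 1) <= p * C `^ (p - 1).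
    apply: (@le_trans _ _ (1 * C `^ (p - 1))); last by rewrite ler_wpM2r ?powR_ge0 // ltW.
    by rewrite mul1r ge0_ler_powR ?nnegrE ?subr_ge0 // ltW.
  have -> : t `^ p = t * t `^ (p - 1) by rewrite mulr_powRB1.
  move: H; have -> : t `^ p = t * t `^ (p - 1) by rewrite mulr_powRB1.
  move=> H; rewrite -mulrA [leRHS]mulrC ler_wpM2l //.
  exact: ler_pM (powR_ge0 _ _) (expR_ge0 _) H2 H.
have {}s00 : 0 < s by rewrite lt_neqAle eq_sym s00.
have cF : {within `[s, t], continuous (fun z => expR (z `^ p))}.
  apply: derivable_within_continuous => z; rewrite in_itv /= => /andP[sz _].
  by case: (dF z (lt_le_trans s00 sz)).
have dF' (z : K) : z \in `]s, t[ ->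
    is_derive z 1 (fun z => expR (z `^ p)) (expR (z `^ p) * (p * z `^ (p - 1))).
  by rewrite in_itv /= => /andP[sz _]; apply: dF; exact: le_lt_trans sz.
have [c] := MVT st dF' cF; rewrite in_itv /= => /andP[sc ct] E.
have c0 : 0 < c by exact: le_lt_trans sc.
have cC : c <= C by rewrite ltW // (lt_le_trans ct).
have H : expR (c `^ p) * (p * c `^ (p - 1)) <= L.
  rewrite /L mulrC ler_pM ?expR_ge0 ?mulr_ge0 ?powR_ge0 // ?(ltW p0) //.
    by rewrite ler_pM2l // ge0_ler_powR ?nnegrE ?subr_ge0 // ltW.
  by apply: exp_power_mono => //; exact: ltW.
rewrite -[_ - _ in leRHS]opprB E -[s - t]opprB mulrN lerN2 ler_wpM2r //.
by rewrite subr_ge0 ltW.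
Qed.

(** One constant for both components, in the form of the coupling that [system_min_principle]
    expects; [R] comes from the convention for ray derivatives. *)
Lemma exists_flux_lipschitz R p q Cu Cv : 0 < R -> 1 < p -> 1 < q -> exists2 L, 0 <= L &
  (forall s t, 0 <= s <= Cv -> 0 <= t <= Cv ->
    L * Num.min (s - t) 0 <= R * (expR (s `^ p) - expR (t `^ p))) /\
  (forall s t, 0 <= s <= Cu -> 0 <= t <= Cu ->
    L * Num.min (s - t) 0 <= R * (expR (s `^ q) - expR (t `^ q))).
Proof.
move=> R0 p1 q1; have [Lp Lp0 HLp] := exp_power_lipschitz Cv p1.
have [Lq Lq0 HLq] := exp_power_lipschitz Cu q1.
have weaken (L L' m d : K) : 0 <= L' -> m <= 0 -> L * m <= d -> R * (L + L') * m <= R * d.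
  by move=> L'0 m0 Lm; rewrite -mulrA ler_pM2l // mulrDl -[d]addr0 lerD // mulr_ge0_le0.
exists (R * (Lp + Lq)); first by rewrite mulr_ge0 ?addr_ge0 // ltW.
split=> s t sC tC; first by apply: weaken (HLp _ _ sC tC) => //; rewrite ge_min lexx orbT.
by rewrite [Lp + _]addrC; apply: weaken (HLq _ _ sC tC) => //; rewrite ge_min lexx orbT.
Qed.

End Flux.

(** * Radial symmetry *)

Section RadialSolution.
Context {K : realType} {n : nat}.
Implicit Types (x y : 'rV[K]_n) (p q R T s t d : K) (u v : 'rV[K]_n -> K -> K).

(** The initial condition is given in the open ball; continuity along rays carries it to the
    sphere. *)
Lemma cball_ext R (w w' : 'rV[K]_n -> K) : 0 < R ->
  {within cball R, continuous w} -> {within cball R, continuous w'} ->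
  (forall x, oball R x -> w x = w' x) -> forall x, cball R x -> w x = w' x.
Proof.
move=> R0 cw cw' ww' x /cballP[/ww' //|xR].
pose g (h : K) := w ((1 - h) *: x) - w' ((1 - h) *: x).
have cg : {within `[0, 1], continuous g}.
  have cray (w1 : 'rV[K]_n -> K) : {within cball R, continuous w1} ->
      {within `[0, 1], continuous (fun h : K => w1 ((1 - h) *: x))}.
    move=> cw1; apply: (within_continuous_comp (g := fun h : K => (1 - h) *: x) cw1).
      exact: continuous_ray.
    by move=> h; rewrite /= in_itv /= => h01; exact: ray_cball.
  by apply: within_continuousD; [|apply: within_continuousN]; exact: cray.
apply/eqP; rewrite -subr_eq0; apply/eqP.
have -> : w x - w' x = g 0 by rewrite /g subr0 scale1r.
apply/eqP/negPn/negP => g0.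
have eps0 : 0 < `|g 0| / 2 by rewrite divr_gt0 // normr_gt0.
have I0 : `[0, 1]%classic (0 : K) by rewrite /= in_itv /= lexx ler01.
move/subspace_continuousP : cg => /(_ 0 I0) /cvgrPdist_le /(_ _ eps0).
rewrite /= /within /= => /nbhs_ballP[r /= r0 Hr].
pose h := Num.min r 1 / 2.
have h0 : 0 < h by rewrite divr_gt0 // lt_min r0 ltr01.
have : h < Num.min r 1 by rewrite ltr_pdivrMr // ltr_pMr ?ltr1n // lt_min r0 ltr01.
rewrite lt_min => /andP[hr h1].
have gh : g h = 0.
  by rewrite /g ww' ?subrr //; apply: ray_oball => //; rewrite h0.
have : `|g 0 - g h| <= `|g 0| / 2.
  apply: Hr; first by rewrite /ball /= sub0r normrN gtr0_norm.
  by rewrite in_itv /= !ltW.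
rewrite gh subr0; lra.
Qed.

Lemma super_at_heat_flux R T u v a b x t : heat_flux R T u a -> heat_flux R T v b ->
  oball R x -> 0 < t < T -> super_at (fun y s => u y s - v y s) x t.
Proof.
move=> [_ hu _] [_ hv _] xR tT.
have [D uD uL] := hu x t xR tT; have [D' vD vL] := hv x t xR tT.
apply: (@super_at_regular _ _ _ _ _ (D - D') (D - D')) => //.
rewrite (_ : D - D' = D + -1 * D'); last by ring.
rewrite (_ : (fun _ => _) = fun y => u y t + -1 * v y t); last first.
  by apply/funext => y; ring.
by apply: has_lapD => //; exact: has_lapZ.
Qed.

(** Invariant under exchanging (p, u) with (q, v), so that each estimate is proved for [u] alone. *)
Definition radial_solution p q R T u v := [/\
  heat_flux R T u (fun x t => expR (v x t `^ p)),
  heat_flux R T v (fun x t => expR (u x t `^ q)),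
  forall x t, cball R x -> 0 <= t < T -> 0 <= u x t /\ 0 <= v x t &
  forall x y t, cball R x -> cball R y -> enorm x = enorm y -> 0 <= t < T ->
    u x t = u y t /\ v x t = v y t].

Lemma radial_solution_sym p q R T u v : radial_solution p q R T u v ->
  radial_solution q p R T v u.
Proof.
move=> [hu hv h0 hr]; split => //.
  by move=> x t xR /(h0 x t xR)[].
by move=> x y t xR yR xy /(hr x y t xR yR xy)[].
Qed.

(** The solution and its image under an orthogonal map solve the same problem with the same radial
    data. On [0, t] both are bounded, the fluxes are Lipschitz, and the minimum principle applies to
    the differences. One inequality is enough, since [x] and [y] can be exchanged. *)
Lemma classical_solution_radial p q R T (u0 v0 : 'rV[K]_n -> K) u v : 1 < p -> 1 < q -> 0 < R -> 0 < T ->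
  {within cball R, continuous u0} -> {within cball R, continuous v0} ->
  radially_symmetric R u0 -> radially_symmetric R v0 ->
  classical_solution p q R u0 v0 T u v ->
  radial_solution p q R T u v.
Proof.
move=> p1 q1 R0 T0 cu0 cv0 ru0 rv0
  [[cu cv] uv0 [u21 v21] heq [[Gu [Gv [hGu hGv hflux]]] init]].
have hu := heat_flux_C21 R0 cu u21 (fun x t xR tT => (heq x t xR tT).1) hGu
  (fun x t xR tT => (hflux x t xR tT).1).
have hv := heat_flux_C21 R0 cv v21 (fun x t xR tT => (heq x t xR tT).2) hGv
  (fun x t xR tT => (hflux x t xR tT).2).
have c0 (w : 'rV[K]_n -> K -> K) : {within cball R `*` `[0, T[, continuous (uncurried w)} ->
    {within cball R, continuous (fun x : 'rV[K]_n => w x 0)}.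
  move=> cw; apply: (within_continuous_comp (g := fun x : 'rV[K]_n => (x, 0)) cw).
    by apply: continuous_pair; [move=> y; exact: cvg_id|exact: cst_continuous].
  by move=> x xR; split => //=; rewrite in_itv /= lexx.
have u0E := cball_ext R0 (c0 u cu) cu0 (fun x xR => (init x xR).1).
have v0E := cball_ext R0 (c0 v cv) cv0 (fun x xR => (init x xR).2).
suff H x y t : cball R x -> cball R y -> enorm x = enorm y -> 0 <= t < T ->
    u y t <= u x t /\ v y t <= v x t.
  split => // x y t xR yR xy tT.
  have [uxy vxy] := H x y t xR yR xy tT; have [uyx vyx] := H y x t yR xR (esym xy) tT.
  by split; apply/eqP; rewrite eq_le ?uxy ?vxy ?uyx ?vyx.
move=> xR yR xy /andP[t0 tT].
have [M MM xM] := exists_orthogonal xy.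
have huM := heat_flux_orthogonal R0 MM cu u21 (fun x t xR tT => (heq x t xR tT).1) hGu
  (fun x t xR tT => (hflux x t xR tT).1).
have hvM := heat_flux_orthogonal R0 MM cv v21 (fun x t xR tT => (heq x t xR tT).2) hGv
  (fun x t xR tT => (hflux x t xR tT).2).
have eM z : enorm (z *m M) = enorm z by exact: enorm_orthogonal.
have MR z : cball R z -> cball R (z *m M) by rewrite /cball /= eM.
have MRb z : bdball R z -> bdball R (z *m M) by rewrite /bdball /= eM.
have [Cu HCu] := within_segment_bounded tT cu.
have [Cv HCv] := within_segment_bounded tT cv.
have [Lam Lam0 [HLp HLq]] := exists_flux_lipschitz Cu Cv R0 p1 q1.
pose xi (b : bool) (z : 'rV[K]_n) s :=
  if b then u z s - u (z *m M) s else v z s - v (z *m M) s.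
have sub s : 0 < s <= t -> 0 < s < T by move=> /andP[-> st]; exact: le_lt_trans tT.
have sub' z : (cball R `*` `[0, t]) z -> (cball R `*` `[0, T[ : set ('rV[K]_n * K)) z.
  case: z => z s [/= zR]; rewrite in_itv /= => /andP[s0 st].
  by split => //=; rewrite in_itv /= s0 (le_lt_trans st).
have key := @system_min_principle K n R 0 t Lam xi R0 Lam0.
have xi_ge0 : forall b z s, cball R z -> 0 <= s <= t -> 0 <= xi b z s.
  apply: key.
  - case; apply: within_continuousD.
    + exact: within_continuousW cu sub'.
    + by apply: within_continuousN; apply: within_continuousW sub'; case: huM.
    + exact: within_continuousW cv sub'.
    + by apply: within_continuousN; apply: within_continuousW sub'; case: hvM.
  - case=> z zR; rewrite /xi.
      by rewrite !u0E ?(ru0 (z *m M) z) ?eM ?subrr //; exact: MR.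
    by rewrite !v0E ?(rv0 (z *m M) z) ?eM ?subrr //; exact: MR.
  - by case=> z s zR st _; [exact: (super_at_heat_flux hu huM zR (sub s st))|
      exact: (super_at_heat_flux hv hvM zR (sub s st))].
  - case=> z s zR st _; have sT := sub s st; have zRc := bdball_cball zR.
      have [_ _ hb] := hu; have [_ _ hbM] := huM.
      exists (R * expR (v z s `^ p) + -1 * (R * expR (v (z *m M) s `^ p))).
        have := ray_derivD (hb z s zR sT) (ray_derivZ (-1) (hbM z s zR sT)).
        rewrite (_ : (fun _ => _) = fun y => xi true y s) //.
        by apply/funext => z'; rewrite /xi; ring.
      have sI : 0 <= s <= t by case/andP: st => /ltW -> ->.
      have sT' : 0 <= s < T by case/andP: sT => /ltW -> ->.
      rewrite mulN1r -mulrBr; apply: HLp; rewrite (uv0 _ _ _ sT').2 ?HCv //; exact: MR.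
    have [_ _ hb] := hv; have [_ _ hbM] := hvM.
    exists (R * expR (u z s `^ q) + -1 * (R * expR (u (z *m M) s `^ q))).
      have := ray_derivD (hb z s zR sT) (ray_derivZ (-1) (hbM z s zR sT)).
      rewrite (_ : (fun _ => _) = fun y => xi false y s) //.
      by apply/funext => z'; rewrite /xi; ring.
    have sI : 0 <= s <= t by case/andP: st => /ltW -> ->.
    have sT' : 0 <= s < T by case/andP: sT => /ltW -> ->.
    rewrite mulN1r -mulrBr; apply: HLq; rewrite (uv0 _ _ _ sT').1 ?HCu //; exact: MR.
have tt : 0 <= t <= t by rewrite t0 lexx.
have := xi_ge0 true x t xR tt; have := xi_ge0 false x t xR tt.
by rewrite /xi xM !subr_ge0.
Qed.

End RadialSolution.

(** * Quadratic barriers *)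

Section Barriers.
Context {K : realType} {n : nat}.
Implicit Types (x y : 'rV[K]_n) (R T s t d m k : K) (u a : 'rV[K]_n -> K -> K).

Lemma min_principle R s t (xi : 'rV[K]_n -> K -> K) : 0 < R ->
  {within cball R `*` `[s, t], continuous (uncurried xi)} ->
  (forall x, cball R x -> 0 <= xi x s) ->
  (forall x t', oball R x -> s < t' <= t -> xi x t' < 0 -> super_at xi x t') ->
  (forall x t', bdball R x -> s < t' <= t -> xi x t' < 0 ->
    exists2 d, ray_deriv (xi^~ t') x d & 0 <= d) ->
  forall x t', cball R x -> s <= t' <= t -> 0 <= xi x t'.
Proof.
move=> R0 cxi xi0 xiint xibd.
suff H (b : bool) x t' : cball R x -> s <= t' <= t -> 0 <= (fun=> xi) b x t' by exact: (H true).
apply: (@system_min_principle K n R s t 0 (fun=> xi) R0 (lexx 0)) => //.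
by move=> _ y s' yR ss neg; have [d yd d0] := xibd y s' yR ss neg; exists d; rewrite ?mul0r.
Qed.

(** An explicit solution of the heat equation with outward normal derivative 2 k R on the sphere. *)
Definition caloric_quadratic m k x t : K := m + k * (sqn x + 2 * n%:R * t).

Lemma is_derive_caloric_quadratic m k x t :
  is_derive t 1 (caloric_quadratic m k x) (k * (2 * n%:R)).
Proof.
have := is_derive_quadratic (m + k * sqn x) (k * (2 * n%:R)) 0 t.
rewrite mulr0 mul0r addr0 (_ : (fun _ => _) = caloric_quadratic m k x) //.
by apply/funext => t'; rewrite /caloric_quadratic; ring.
Qed.

Lemma has_lap_caloric_quadratic m k x t :
  has_lap (caloric_quadratic m k ^~ t) x (k * (2 * n%:R)).
Proof.
have lsq : has_lap (fun z => sqn z) x (2 * n%:R * 1 + 4 * sqn x * 0).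
  by apply: (has_lap_radial (c := fun s => s) (c1 := fun=> 1) ltr01).
have := has_lapD (has_lap_cst m x) (has_lapZ k (has_lapD lsq (has_lap_cst (2 * n%:R * t) x))).
by rewrite mulr0 !addr0 mulr1 add0r.
Qed.

Lemma ray_deriv_caloric_quadratic R m k x t : bdball R x ->
  ray_deriv (caloric_quadratic m k ^~ t) x (k * (2 * R ^+ 2)).
Proof.
move=> xR.
have dsq : ray_deriv (fun z => sqn z) x (2 * sqn x * 1).
  exact: (ray_deriv_radial (c := fun s => s)).
have := ray_derivD (ray_deriv_cst m x)
  (ray_derivZ k (ray_derivD dsq (ray_deriv_cst (2 * n%:R * t) x))).
by rewrite add0r addr0 mulr1 (sqn_bdball xR).
Qed.

Lemma continuous_caloric_quadratic m k : continuous (uncurried (caloric_quadratic m k)).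
Proof.
have c1 : continuous (fun z : 'rV[K]_n * K => sqn z.1 + 2 * n%:R * z.2).
  move=> z; apply: cvgD; last by apply: cvgM; [exact: cvg_cst|exact: cvg_snd].
  by apply: (@continuous_comp _ _ _ fst sqn); [exact: cvg_fst|exact: continuous_sqn].
move=> z; apply: cvgD; first exact: cvg_cst.
by apply: cvgM; [exact: cvg_cst|exact: c1].
Qed.

(** The barrier is at least [m], so the flux has to be bounded only where [u > m]; this is what
    makes the bound usable when the flux is controlled at some times only. *)
Lemma upper_barrier R T u a m k t : 0 < R -> heat_flux R T u a -> 0 <= k -> 0 <= t < T ->
  (forall x, cball R x -> u x 0 <= m) ->
  (forall x s, bdball R x -> 0 < s <= t -> m < u x s -> a x s <= 2 * k * R) ->
  forall x, cball R x -> u x t <= m + k * (sqn x + 2 * n%:R * t).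
Proof.
move=> R0 [cu hu hb] k0 /andP[t0 tT] um abd x xR.
pose xi y s := -1 * u y s + caloric_quadratic m k y s.
have tt : 0 <= t <= t by rewrite t0 lexx.
suff : 0 <= xi x t by rewrite /xi /caloric_quadratic; lra.
apply: (min_principle R0 _ _ _ _ xR tt).
- apply: within_continuousD.
    apply: within_continuousM; first by apply: continuous_within; exact: cst_continuous.
    apply: within_continuousW cu _ => -[y s] [/= yR]; rewrite in_itv /= => /andP[s0 st].
    by split => //=; rewrite in_itv /= s0 (le_lt_trans st).
  by apply: continuous_within; exact: continuous_caloric_quadratic.
- move=> y yR; rewrite /xi /caloric_quadratic mulr0 addr0.
  by have := um y yR; have := mulr_ge0 k0 (sqn_ge0 y); lra.
- move=> y s yR /andP[s0 st] _; have sT : 0 < s < T by rewrite s0 (le_lt_trans st).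
  have [D uD uL] := hu y s yR sT.
  apply: (super_at_regular (D := -1 * D + k * (2 * n%:R)) (L := -1 * D + k * (2 * n%:R))) => //.
    have d1 := is_derive_mull (-1) uD; have d2 := is_derive_caloric_quadratic m k y s.
    exact: is_deriveD.
  exact: has_lapD (has_lapZ _ uL) (has_lap_caloric_quadratic m k y s).
- move=> y s yR /andP[s0 st] neg; have sT : 0 < s < T by rewrite s0 (le_lt_trans st).
  exists (-1 * (R * a y s) + k * (2 * R ^+ 2)).
    exact: ray_derivD (ray_derivZ _ (hb y s yR sT)) (ray_deriv_caloric_quadratic m k s yR).
  have : a y s <= 2 * k * R.
    apply: abd => //; first by rewrite s0.
    move: neg; rewrite /xi /caloric_quadratic.
    have : 0 <= k * (sqn y + 2 * n%:R * s).
      by rewrite mulr_ge0 // addr_ge0 ?sqn_ge0 // !mulr_ge0 // ltW.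
    lra.
  by rewrite -(ler_pM2l R0); lra.
Qed.

Lemma lower_barrier R T u a (c : K) t1 t : 0 < R -> heat_flux R T u a -> 0 <= c ->
  0 <= t1 -> t1 <= t -> t < T ->
  (forall x, cball R x -> 0 <= u x t1) ->
  (forall x s, bdball R x -> t1 < s <= t -> c <= a x s) ->
  forall x, bdball R x -> n%:R / R * (t - t1) * c <= u x t.
Proof.
move=> R0 [cu hu hb] c0 t10 t1t tT u0 abd x xR.
pose k := c / (2 * R).
have kR : k * (2 * R) = c by rewrite /k divfK // gt_eqF // mulr_gt0.
have k0 : 0 <= k by rewrite divr_ge0 // mulr_ge0 // ltW.
(* Makes the barrier vanish on the sphere at time [t1], hence nonpositive in the ball; on the sphere
   it then grows at rate 2 n k = (n/R) c. *)
pose m := - k * (R ^+ 2 + 2 * n%:R * t1).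
pose xi y s := u y s + -1 * caloric_quadratic m k y s.
have tt : t1 <= t <= t by rewrite t1t lexx.
have E : caloric_quadratic m k x t = n%:R / R * (t - t1) * c.
  by rewrite /caloric_quadratic /m (sqn_bdball xR) -kR; field; rewrite gt_eqF.
suff : 0 <= xi x t by rewrite /xi E; lra.
apply: (min_principle R0 _ _ _ _ (bdball_cball xR) tt).
- apply: within_continuousD.
    apply: within_continuousW cu _ => -[y s] [/= yR]; rewrite in_itv /= => /andP[s0 st].
    by split => //=; rewrite in_itv /= (le_trans t10 s0) (le_lt_trans st).
  apply: within_continuousM; first by apply: continuous_within; exact: cst_continuous.
  by apply: continuous_within; exact: continuous_caloric_quadratic.
- move=> y yR; rewrite /xi /caloric_quadratic /m.
  have := u0 y yR; have : k * sqn y <= k * R ^+ 2 by rewrite ler_wpM2l // sqn_cball.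
  lra.
- move=> y s yR /andP[s0 st] _.
  have sT : 0 < s < T by rewrite (le_lt_trans t10 s0) (le_lt_trans st).
  have [D uD uL] := hu y s yR sT.
  apply: (super_at_regular (D := D + -1 * (k * (2 * n%:R))) (L := D + -1 * (k * (2 * n%:R)))) => //.
    have d2 := is_derive_mull (-1) (is_derive_caloric_quadratic m k y s).
    exact: is_deriveD.
  exact: has_lapD uL (has_lapZ _ (has_lap_caloric_quadratic m k y s)).
- move=> y s yR /andP[s0 st] neg.
  have sT : 0 < s < T by rewrite (le_lt_trans t10 s0) (le_lt_trans st).
  exists (R * a y s + -1 * (k * (2 * R ^+ 2))).
    exact: ray_derivD (hb y s yR sT) (ray_derivZ _ (ray_deriv_caloric_quadratic m k s yR)).
  have : c <= a y s by apply: abd => //; rewrite s0.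
  by rewrite -(ler_pM2l R0) -{1}kR; lra.
Qed.

End Barriers.

(** * Subsolutions from tangent profiles *)

Section Persistence.
Context {K : realType} {n : nat}.
Implicit Types (x y z b : 'rV[K]_n) (p q R T s t d A B C : K) (u v : 'rV[K]_n -> K -> K)
  (H : 'rV[K]_n -> K).

Lemma within_cylinder_harmonic R C H (a c : K) u (D : set ('rV[K]_n * K)) :
  harmonic_barrier R C H -> {within D, continuous (uncurried u)} ->
  {within D, continuous (uncurried (fun y s => u y s + (a * H y + c)))}.
Proof.
move=> [cH _ _ _ _] cu; apply: within_continuousD cu _; apply: continuous_within.
have cHz : continuous (fun z : 'rV[K]_n * K => a * H z.1).
  move=> z; apply: cvgM; first exact: cvg_cst.
  by apply: (@continuous_comp _ _ _ fst H); [exact: cvg_fst|exact: cH].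
by move=> z; apply: cvgD; [exact: cHz|exact: cvg_cst].
Qed.

(** The hypothesis on earlier times says that no earlier pair of boundary values beats the pair at
    [s] in both components. It keeps the flux of [u] at most [expR (v b s ^ p)] whenever [u] exceeds
    its level on the sphere. *)
Lemma tangent_from_below p q R T u v s b H C : (0 < n)%N -> 0 < p -> 0 < R ->
  radial_solution p q R T u v -> 0 < s < T -> bdball R b ->
  harmonic_barrier R C H -> u b s < expR (v b s `^ p) * C ->
  u b 0 <= u b s ->
  (forall t, 0 < t <= s -> u b s < u b t -> v b t <= v b s) ->
  (forall z, oball R z -> exists2 L, has_lap (u^~ 0) z L & 0 <= L) ->
  forall x, cball R x -> u b s <= u x s + expR (v b s `^ p) * H x.
Proof.
move=> n0 p0 R0 [hu hv uv0 rad] sT bR hH AC u0s pareto sub x0 x0R.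
have [cH rH bdH lapH1 lapH2] := hH; have [cu iu bu] := hu.
have bRc := bdball_cball bR.
move: sT => /andP[s0 sT].
have tI t : 0 <= t <= s -> 0 <= t < T by move=> /andP[-> ts]; exact: le_lt_trans sT.
have tI' t : 0 < t <= s -> 0 < t < T by move=> /andP[-> ts]; exact: le_lt_trans sT.
have ub x t : bdball R x -> 0 <= t <= s -> u x t = u b t /\ v x t = v b t.
  move=> xR /tI tT; apply: rad => //; first exact: bdball_cball.
  by rewrite (xR : enorm x = R) (bR : enorm b = R).
have ss : 0 <= s <= s by rewrite lexx ltW.
set A := u b s in AC u0s pareto *; set al := expR _ in AC *.
have al0 : 0 < al by exact: expR_gt0.
have A0 : 0 <= A by case: (uv0 b s bRc (tI s ss)).
have C0 : 0 < C by rewrite -(pmulr_rgt0 _ al0); exact: le_lt_trans AC.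
rewrite leNgt; apply/negP => neg.
have N0 : 0 < 2 * (`|H x0| + 1) by rewrite mulr_gt0 // ltr_wpDl.
(* A tilt of the slope small enough that eta |H x0| uses less than half of the assumed gap at [x0],
   so [xi x0 s] is still negative. *)
pose eta := (A - (u x0 s + al * H x0)) / (2 * (`|H x0| + 1)).
have eta0 : 0 < eta by rewrite divr_gt0 // subr_gt0.
have etaE : eta * (2 * (`|H x0| + 1)) = A - (u x0 s + al * H x0).
  by rewrite /eta divfK // gt_eqF.
pose be := al + eta.
have be0 : 0 < be by rewrite addr_gt0.
have beC : A < be * C.
  by apply: lt_trans AC _; rewrite ltr_pM2r // /be ltrDl.
pose xi y t := u y t + (be * H y + - A).
have neg0 : xi x0 s < 0.
  rewrite /xi /be; have : eta * H x0 <= eta * `|H x0| by rewrite ler_pM2l // ler_norm.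
  have : 0 <= eta * `|H x0| by rewrite mulr_ge0 // ltW.
  lra.
have HC y t : cball R y -> 0 <= t <= s -> xi y t < 0 -> H y <= C.
  move=> yR ts; have [uy _] := uv0 y t yR (tI t ts).
  rewrite /xi => yneg; rewrite -(ler_pM2l be0); lra.
have lapxi t z D : 0 < t -> has_lap (u^~ t) z D -> has_lap H z 0 -> has_lap (xi^~ t) z D.
  move=> _ uD Hz; have := has_lapD uD (has_lapD (has_lapZ be Hz) (has_lap_cst (- A) z)).
  by rewrite mulr0 !addr0.
have derxi t y (D : K) : is_derive t 1 (u y) D -> is_derive t 1 (xi y) D.
  move=> uD; have := is_deriveD uD (is_derive_cst (be * H y + - A) t 1).
  by rewrite addr0.
have rayxi x t : bdball R x -> 0 < t <= s ->
    ray_deriv (xi^~ t) x (R * expR (v x t `^ p) + (be * - R + 0)).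
  move=> xR /andP[t0 ts]; apply: ray_derivD.
    by apply: bu => //; rewrite t0 (le_lt_trans ts).
  by apply: ray_derivD; [apply: ray_derivZ; case: (bdH x xR)|exact: ray_deriv_cst].
have xibd x t : bdball R x -> 0 <= t <= s -> xi x t = u b t - A.
  by move=> xR ts; rewrite /xi (bdH x xR).1 mulr0 add0r (ub x t xR ts).1.
have cxi : {within cball R `*` `[0, s], continuous (uncurried xi)}.
  suff cu' : {within cball R `*` `[0, s], continuous (uncurried u)}.
    exact: (within_cylinder_harmonic (a := be) (c := - A) hH cu').
  apply: within_continuousW cu _ => -[y t] [/= yR]; rewrite in_itv /= => ts.
  by split => //=; rewrite in_itv; exact: tI.
have xrad x y t : cball R x -> cball R y -> 0 <= t <= s -> enorm x = enorm y -> xi x t = xi y t.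
  move=> xR yR ts xy; rewrite /xi (rH x y xy).
  by have [-> _] := rad x y t xR yR xy (tI t ts).
have crossing : forall x y, cball R x -> cball R y -> enorm y <= enorm x ->
    xi y s < 0 -> xi x s <= 0.
  apply: (single_crossing R0 cxi xrad) => //; last exact: ltW.
  - move=> x y t xR tt yx yneg; have /andP[t0 ts] := tt.
    have [D uD uL] := iu x t xR (tI' t tt).
    have yR : cball R y by apply: le_trans (ltW yx) (ltW xR).
    exists D; first exact: derxi.
    apply: (lapxi t x D t0 uL); apply: lapH1 yx _; apply: (HC y t yR) => //.
    by rewrite ts ltW.
  - move=> y t yR tt yneg; have /andP[t0 ts] := tt.
    have [D uD uL] := iu y t yR (tI' t tt).
    have HyC : H y <= C by apply: (HC y t (oball_cball yR)) => //; rewrite ts ltW.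
    have [Hy|Hy] := lapH2 y HyC; [left|right].
      by exists D; [exact: derxi|exact: lapxi].
    move=> Aset oA Ay ymin.
    apply: (peak_no_min (has_lapD uL (has_lap_cst (- A) y)) Hy be0 oA Ay) => z /ymin.
    by rewrite /xi; lra.
  - move=> x t xR ts; have ts' : 0 <= t <= s by case/andP: ts => /ltW -> ->.
    rewrite xibd // subr_gt0 => fA.
    exists (R * expR (v x t `^ p) + (be * - R + 0)); first exact: rayxi.
    have vt := pareto t ts fA.
    have : expR (v x t `^ p) <= al.
      rewrite (ub x t xR ts').2; apply: exp_power_mono (ltW p0) _ _ _ vt.
      by case: (uv0 b t bRc (tI t ts')).
    rewrite -(ler_pM2l R0) /be; have := mulr_gt0 eta0 R0; lra.
  - move=> x y xR yR yx yneg.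
    have zI : 0 <= (0 : K) <= s by rewrite lexx ltW.
    have cw : {within cball R, continuous (xi^~ 0)}.
      apply: (within_continuous_comp (g := fun y => (y, 0)) cxi).
        by apply: continuous_pair; [move=> z; exact: cvg_id|exact: cst_continuous].
      by move=> z zR; split => //=; rewrite in_itv.
    apply: (subharmonic_crossing R0 n0 cw _ _ _ xR yR yx yneg).
    + by move=> x' y' x'R y'R xy'; exact: xrad.
    + move=> z zR yz; have [L uL L0] := sub z zR; exists L => //.
      have := has_lapD uL (has_lapD (has_lapZ be (lapH1 y z yz (HC y 0 yR zI yneg)))
        (has_lap_cst (- A) z)).
      by rewrite mulr0 !addr0.
    + by move=> z zR; rewrite xibd // subr_le0.
have [x0i|x0b] := cballP x0R; last first.
  by move: neg0; rewrite xibd // subrr ltxx.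
have ss' : 0 < s <= s by rewrite s0 lexx.
(* The crossing property makes [xi] nonpositive from [x0] out to the sphere, where it vanishes at
   [b]; its ray derivative there is -R eta < 0, a contradiction. *)
have d0 := ray_derivZ (-1) (rayxi b s bR ss').
have r0 : 0 < 1 - enorm x0 / R by rewrite subr_gt0 ltr_pdivrMr // mul1r.
suff : -1 * (R * al + (be * - R + 0)) <= 0.
  by rewrite /be; have := mulr_gt0 eta0 R0; lra.
apply: (ray_deriv_le0 d0 r0) => h /andP[h0 hr].
rewrite [xi b s]xibd // subrr mulr0 mulN1r oppr_ge0.
have e0 := enorm_ge0 x0.
have hy : enorm x0 < (1 - h) * R by move: hr; rewrite ltrBrDr -ltrBrDl ltr_pdivrMr.
have h1 : 0 < 1 - h by rewrite -(pmulr_lgt0 _ R0); exact: le_lt_trans hy.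
apply: (crossing _ x0) => //.
  by apply: ray_cball => //; rewrite (ltW h0) /=; lra.
by rewrite enormZ gtr0_norm // (bR : enorm b = R) ltW.
Qed.

(** Comparison with the stationary pair of profiles. On the sphere H = 0, so the flux differences
    are bounded below by the differences of the boundary values, which is the cooperative
    coupling. *)
Lemma stay_above p q R T u v s b H C A B : 1 < p -> 1 < q -> 0 < R ->
  radial_solution p q R T u v -> 0 <= s -> bdball R b ->
  harmonic_barrier R C H -> 0 <= A -> 0 <= B ->
  A < expR (B `^ p) * C -> B < expR (A `^ q) * C ->
  (forall x, cball R x -> A <= u x s + expR (B `^ p) * H x) ->
  (forall x, cball R x -> B <= v x s + expR (A `^ q) * H x) ->
  forall t, s <= t < T -> A <= u b t /\ B <= v b t.
Proof.
move=> p1 q1 R0 [hu hv uv0 rad] s0 bR hH A0 B0 AC BC uA vB t /andP[st tT].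
have [cH rH bdH _ lapH2] := hH; have [cu iu bu] := hu; have [cv iv bv] := hv.
set al := expR (B `^ p) in AC uA *; set be := expR (A `^ q) in BC vB *.
have al0 : 0 < al by exact: expR_gt0.
have be0 : 0 < be by exact: expR_gt0.
have bRc := bdball_cball bR.
have [Cu HCu] := within_segment_bounded tT cu.
have [Cv HCv] := within_segment_bounded tT cv.
have [Lam Lam0 [HLp HLq]] := exists_flux_lipschitz Cu Cv R0 p1 q1.
pose xi (c : bool) y t := if c then (u y t + - A) + al * H y else (v y t + - B) + be * H y.
have tI t' : s < t' <= t -> 0 < t' < T.
  by move=> /andP[st' t't]; rewrite (le_lt_trans s0 st') (le_lt_trans t't).
have sub (Z : 'rV[K]_n * K) : (cball R `*` `[s, t]) Z -> (cball R `*` `[0, T[) Z.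
  case: Z => z t' [/= zR]; rewrite in_itv /= => /andP[st' t't].
  by split => //=; rewrite in_itv /= (le_trans s0 st') (le_lt_trans t't).
have sI : 0 <= s <= t by rewrite s0 st.
have bdu := uA b bRc; rewrite (bdH b bR).1 mulr0 addr0 in bdu.
have bdv := vB b bRc; rewrite (bdH b bR).1 mulr0 addr0 in bdv.
have ACu : 0 <= A <= Cu by rewrite A0 (le_trans bdu) // HCu.
have BCv : 0 <= B <= Cv by rewrite B0 (le_trans bdv) // HCv.
have xi_ge0 : forall c y t', cball R y -> s <= t' <= t -> 0 <= xi c y t'.
  apply: (system_min_principle R0 Lam0).
  - case.
      rewrite (_ : xi true = fun y s => u y s + (al * H y + - A)); last first.
        by apply/funext => y; apply/funext => t'; rewrite /xi; ring.
      exact: (within_cylinder_harmonic (a := al) (c := - A) hH (within_continuousW cu sub)).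
    rewrite (_ : xi false = fun y s => v y s + (be * H y + - B)); last first.
      by apply/funext => y; apply/funext => t'; rewrite /xi; ring.
    exact: (within_cylinder_harmonic (a := be) (c := - B) hH (within_continuousW cv sub)).
  - by case=> y yR; rewrite /xi; [have := uA y yR|have := vB y yR]; lra.
  - case=> y t' yR /tI t'T; rewrite /xi => yneg.
      have t'T' : 0 <= t' < T by case/andP: t'T => /ltW -> ->.
      have [uy _] := uv0 y t' (oball_cball yR) t'T'.
      have HC : H y <= C by rewrite -(ler_pM2l al0); lra.
      have [D uD uL] := iu y t' yR t'T.
      have uL' := has_lapD uL (has_lap_cst (- A) y).
      have [Hy|Hy] := lapH2 y HC.
        apply: (super_at_regular (D := D) (L := D)) => //.
          have := is_deriveD (is_deriveD uD (is_derive_cst (- A) t' 1)) (is_derive_cst (al * H y) t' 1).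
          by rewrite !addr0.
        have := has_lapD uL' (has_lapZ al Hy).
        by rewrite mulr0 !addr0.
      exact: (super_at_peak (u := fun y s => u y s + - A) uL' Hy al0).
    have t'T' : 0 <= t' < T by case/andP: t'T => /ltW -> ->.
    have [_ vy] := uv0 y t' (oball_cball yR) t'T'.
    have HC : H y <= C by rewrite -(ler_pM2l be0); lra.
    have [D vD vL] := iv y t' yR t'T.
    have vL' := has_lapD vL (has_lap_cst (- B) y).
    have [Hy|Hy] := lapH2 y HC.
      apply: (super_at_regular (D := D) (L := D)) => //.
        have := is_deriveD (is_deriveD vD (is_derive_cst (- B) t' 1)) (is_derive_cst (be * H y) t' 1).
        by rewrite !addr0.
      have := has_lapD vL' (has_lapZ be Hy).
      by rewrite mulr0 !addr0.
    exact: (super_at_peak (u := fun y s => v y s + - B) vL' Hy be0).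
  - case=> y t' yR st' _; have t'T := tI t' st'.
      have [Hy dH] := bdH y yR; have yRc := bdball_cball yR.
      have t'T' : 0 <= t' < T by case/andP: t'T => /ltW -> ->.
      have [uy vy] := uv0 y t' yRc t'T'.
      have t'I : 0 <= t' <= t by case/andP: t'T' => ->; case/andP: st' => _ ->.
      exists (R * expR (v y t' `^ p) + 0 + al * - R).
        apply: ray_derivD; last exact: ray_derivZ.
        by apply: ray_derivD; [exact: bu|exact: ray_deriv_cst].
      rewrite addr0 mulrN [al * R]mulrC -mulrBr /xi /= Hy mulr0 addr0.
      by apply: HLp => //; rewrite vy HCv.
    have [Hy dH] := bdH y yR; have yRc := bdball_cball yR.
    have t'T' : 0 <= t' < T by case/andP: t'T => /ltW -> ->.
    have [uy vy] := uv0 y t' yRc t'T'.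
    have t'I : 0 <= t' <= t by case/andP: t'T' => ->; case/andP: st' => _ ->.
    exists (R * expR (u y t' `^ q) + 0 + be * - R).
      apply: ray_derivD; last exact: ray_derivZ.
      by apply: ray_derivD; [exact: bv|exact: ray_deriv_cst].
    rewrite addr0 mulrN [be * R]mulrC -mulrBr /xi /= Hy mulr0 addr0.
    by apply: HLq => //; rewrite uy HCu.
have tt : s <= t <= t by rewrite st lexx.
have := xi_ge0 true b t bRc tt; have := xi_ge0 false b t bRc tt.
by rewrite /xi (bdH b bR).1 !mulr0; split; lra.
Qed.

End Persistence.

(** * Growth of alternating sequences *)

Section Bootstrap.
Context {K : realType}.
Implicit Types (f g : K -> K) (p q c s t T a : K).

(** The infimum of the closed set of times at which both functions are at least their values at
    [t0]. *)
Lemma first_entry f g t0 : 0 <= t0 -> {within `[0, t0], continuous f} ->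
  {within `[0, t0], continuous g} ->
  exists s, [/\ 0 <= s <= t0, f t0 <= f s, g t0 <= g s &
    forall t, 0 <= t < s -> f t < f t0 \/ g t < g t0].
Proof.
move=> t00 cf cg.
pose S := [set t | [/\ 0 <= t <= t0, f t0 <= f t & g t0 <= g t]].
have St0 : S t0 by split; rewrite ?t00 ?lexx.
have hS : has_inf S by split; [exists t0|exists 0 => t [/andP[]]].
pose s := inf S.
have s0 : 0 <= s by apply: lb_le_inf; [exists t0|move=> t [/andP[]]].
have sle t : S t -> s <= t by move=> St; apply: ge_inf => //; exact: hS.2.
have st0 : s <= t0 by exact: sle.
have sI : 0 <= s <= t0 by rewrite s0.
have closedS (h : K -> K) : {within `[0, t0], continuous h} ->
    (forall t, S t -> h t0 <= h t) -> h t0 <= h s.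
  move=> ch hle; rewrite leNgt; apply/negP => hs.
  have e0 : 0 < (h t0 - h s) / 2 by rewrite divr_gt0 // subr_gt0.
  have I0 : `[0, t0]%classic s by rewrite /= in_itv.
  move/subspace_continuousP : ch => /(_ s I0) /cvgrPdist_le /(_ _ e0).
  rewrite /= /within /= => /nbhs_ballP[r /= r0 Hr].
  have [t St tr] := inf_adherent r0 hS; have [/andP[t1 t2] _ _] := St.
  have : `|h s - h t| <= (h t0 - h s) / 2.
    apply: Hr; last by rewrite in_itv /= t1.
    by rewrite /ball /= distrC ger0_norm ?subr_ge0 ?sle // ltrBlDl.
  by rewrite ler_norml => /andP[H _]; have := hle t St; lra.
exists s; split => //.
- by apply: closedS => // t [].
- by apply: closedS => // t [].
- move=> t /andP[t1 ts]; have [ft|ft] := ltrP (f t) (f t0); [by left|right].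
  rewrite ltNge; apply/negP => gt; have := ts; rewrite ltNge sle //.
  by split=> //; rewrite t1 (le_trans (ltW ts)).
Qed.

(** The threshold [s0] solves s^(p-1) = a: beyond it s^p >= a s, and before it a s - a s0 is
    negative. *)
Lemma superlinear_power p a : 1 < p -> 0 < a ->
  exists D, forall s, 0 <= s -> a * s - D <= s `^ p.
Proof.
move=> p1 a0; have p10 : 0 < p - 1 by rewrite subr_gt0.
pose s0 := a `^ (p - 1)^-1.
exists (a * s0) => s s_ge0.
have s00 : 0 < s0 by exact: powR_gt0.
have [s0s|ss0] := lerP s0 s.
  have H : a <= s `^ (p - 1).
    have -> : a = s0 `^ (p - 1) by rewrite /s0 -powRrM mulVf ?gt_eqF // powRr1 // ltW.
    by rewrite ge0_ler_powR ?nnegrE // ltW.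
  have -> : s `^ p = s * s `^ (p - 1) by rewrite mulr_powRB1 // (lt_trans _ p1).
  have : s * a <= s * s `^ (p - 1) by rewrite ler_wpM2l.
  by have := mulr_gt0 a0 s00; lra.
apply: le_trans (powR_ge0 s p); rewrite subr_le0 ler_pM2l //; exact: ltW.
Qed.

(* With [t_k = t + (T - t)(1 - 2^-k)/2], the alternating values [f t_0, g t_1,
   f t_2, ...] would grow at least like [f t_0 + k] if [f t_0] were too large,
   although [f] and [g] are bounded up to [(t + T)/2 < T]. *)
Lemma alternating_growth_bound f g p q T ts c gam : 1 < p -> 1 < q -> 0 < c -> 0 < gam ->
  (forall t, ts <= t < T -> 0 <= f t /\ 0 <= g t) ->
  (forall t, ts <= t < T -> exists C, forall s, ts <= s <= t -> f s <= C /\ g s <= C) ->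
  (forall s t, ts <= s -> s <= t -> t < T ->
    c * (t - s) * expR (g s `^ p) <= f t /\ c * (t - s) * expR (f s `^ q) <= g t) ->
  exists C, forall t, ts <= t < T -> f t <= Num.max 0 (C - gam * ln (T - t)).
Proof.
move=> p1 q1 c0 gam0 fg0 bnd grow.
(* The part 1/gam absorbs the factor T - t0. The part 2 supplies exp(k) against 2^-k, a second
   exp(k), and exp(f t0), the last two giving growth. *)
pose lam := 2 + gam^-1.
have gamV0 : 0 < gam^-1 by rewrite invr_gt0.
have lam0 : 0 < lam by rewrite addr_gt0.
have [Dp HDp] := superlinear_power p1 lam0.
have [Dq HDq] := superlinear_power q1 lam0.
(* Absorbs the additive constants, so that c exp(z^p) and c exp(z^q) both dominate c' exp(lam z). *)
pose c' := c * expR (- (`|Dp| + `|Dq|)).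
have c'0 : 0 < c' by rewrite mulr_gt0 // expR_gt0.
exists (gam * ln (4 / c')) => t0 t0I; have [t0s t0T] := andP t0I.
pose d := T - t0; have d0 : 0 < d by rewrite subr_gt0.
rewrite leNgt; apply/negP; rewrite gt_max => /andP[M0 ML].
have big : 1 <= c' * d / 4 * expR ((lam - 1) * f t0).
  have k0 : 0 < c' * d / 4 by rewrite divr_gt0 // mulr_gt0.
  rewrite -[c' * d / 4]lnK ?posrE // -expRD -[leLHS]expR0 ler_expR.
  have -> : ln (c' * d / 4) = - ln (4 / c') + ln d.
    rewrite -lnV ?posrE ?divr_gt0 // invf_div -lnM ?posrE ?divr_gt0 //.
    by congr ln; ring.
  have : gam^-1 * (gam * ln (4 / c') - gam * ln d) < gam^-1 * f t0 by rewrite ltr_pM2l.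
  rewrite -mulrBr mulKf ?gt_eqF // /lam => H.
  have : 0 <= f t0 by exact: ltW.
  lra.
pose tk (k : nat) := t0 + d / 2 * (1 - 2^-1 ^+ k).
pose y (k : nat) := if odd k then g (tk k) else f (tk k).
have pw0 (k : nat) : 0 < 2^-1 ^+ k :> K by rewrite exprn_gt0 // invr_gt0.
have pw1 (k : nat) : 2^-1 ^+ k <= 1 :> K.
  by rewrite exprn_ile1 ?invr_ge0 // invf_le1 ?ler1n.
have tkI (k : nat) : ts <= tk k <= t0 + d / 2.
  have d2 : 0 < d / 2 by rewrite divr_gt0.
  have := mulr_gt0 d2 (pw0 k); have : 0 <= d / 2 * (1 - 2^-1 ^+ k).
    by rewrite mulr_ge0 ?subr_ge0 // ltW.
  by rewrite /tk => H1 H2; apply/andP; split; lra.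
have tkT (k : nat) : tk k < T.
  by case/andP: (tkI k) => _ H; apply: le_lt_trans H _; rewrite /d; lra.
have tkS (k : nat) : tk k.+1 - tk k = d / 4 * 2^-1 ^+ k.
  by rewrite /tk exprS; field.
have ynn (k : nat) : 0 <= y k.
  rewrite /y; have [fk gk] : 0 <= f (tk k) /\ 0 <= g (tk k).
    by apply: fg0; rewrite tkT andbT; case/andP: (tkI k).
  by case: ifP.
have step (k : nat) : c' * d / 4 * 2^-1 ^+ k * expR (lam * y k) <= y k.+1.
  have tk1 : tk k <= tk k.+1.
    by rewrite -subr_ge0 tkS mulr_ge0 ?divr_ge0 ?(ltW d0) // ltW.
  have [H1 H2] := grow (tk k) (tk k.+1) (proj1 (andP (tkI k))) tk1 (tkT k.+1).
  have expo (z D P : K) : lam * z - D <= P -> `|D| <= `|Dp| + `|Dq| ->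
      c' * d / 4 * 2^-1 ^+ k * expR (lam * z) <= c * (tk k.+1 - tk k) * expR P.
    move=> HP HD; rewrite tkS /c'.
    have -> : c * expR (- (`|Dp| + `|Dq|)) * d / 4 * 2^-1 ^+ k * expR (lam * z) =
       c * (d / 4 * 2^-1 ^+ k) * (expR (- (`|Dp| + `|Dq|)) * expR (lam * z)) by ring.
    rewrite ler_pM2l; last by rewrite !mulr_gt0 ?divr_gt0.
    by rewrite -expRD ler_expR; have := ler_norm D; lra.
  have := ynn k; rewrite /y /=; case: (odd k) => /= yk.
    apply: le_trans H1; apply: expo (HDp _ yk) _.
    by rewrite lerDl.
  apply: le_trans H2; apply: expo (HDq _ yk) _.
  by rewrite lerDr.
have ygrow (k : nat) : f t0 + k%:R <= y k.
  elim: k => [|k IH].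
    by rewrite /y /tk expr0 subrr mulr0 !addr0.
  apply: le_trans (step k).
  have lam1 : 2 <= lam by rewrite /lam; lra.
  have H1 : expR ((lam - 1) * f t0) * expR (f t0) * (expR k%:R * expR k%:R) <= expR (lam * y k).
    rewrite -!expRD ler_expR.
    have : lam * (f t0 + k%:R) <= lam * y k by rewrite ler_pM2l.
    have : 2 * k%:R <= lam * k%:R :> K by rewrite ler_wpM2r.
    lra.
  (* The time steps shrink like 2^-k, and e >= 2 compensates for it. *)
  have e2 : 1 <= 2^-1 ^+ k * expR k%:R :> K.
    rewrite -[X in expR X]mulr1 expRM_natl -exprMn; apply: exprn_ege1.
    by have := expR_ge1Dx (1 : K); lra.
  have k1 : 1 + k%:R <= expR k%:R :> K by exact: expR_ge1Dx.
  have f1 : 1 + f t0 <= expR (f t0) by exact: expR_ge1Dx.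
  have a0 : 0 <= c' * d / 4 * 2^-1 ^+ k.
    by rewrite !mulr_ge0 ?invr_ge0 // ltW.
  apply: le_trans (ler_wpM2l a0 H1).
  have -> : c' * d / 4 * 2^-1 ^+ k *
      (expR ((lam - 1) * f t0) * expR (f t0) * (expR k%:R * expR k%:R)) =
    (c' * d / 4 * expR ((lam - 1) * f t0)) * (2^-1 ^+ k * expR k%:R) *
      (expR (f t0) * expR k%:R) by ring.
  have P1 : 1 <= (c' * d / 4 * expR ((lam - 1) * f t0)) * (2^-1 ^+ k * expR k%:R).
    by rewrite -[leLHS]mulr1; apply: ler_pM.
  have P2 : (1 + f t0) * (1 + k%:R) <= expR (f t0) * expR k%:R.
    by apply: ler_pM => //; rewrite addr_ge0 // ltW.
  have P3 : f t0 + k.+1%:R <= (1 + f t0) * (1 + k%:R).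
    have : 0 <= f t0 * k%:R by rewrite mulr_ge0 // ltW.
    by rewrite -natr1; lra.
  apply: (le_trans P3); apply: (le_trans P2).
  by rewrite -[leLHS]mul1r ler_wpM2r // mulr_ge0 // expR_ge0.
have [|B HB] := bnd (t0 + d / 2).
  by apply/andP; split; rewrite /d in d0 *; lra.
have [k kB] : exists k : nat, B < k%:R.
  by exists (Num.Def.truncn `|B|).+1; apply: le_lt_trans (ler_norm B) _; exact: truncnS_gt.
have [fk gk] := HB (tk k) (tkI k).
have : y k <= B by rewrite /y; case: ifP.
by have := ygrow k; lra.
Qed.

End Bootstrap.

(** * The blow-up rate *)

Section BlowUpRate.
Context {K : realType} {n : nat}.
Implicit Types (x y z b : 'rV[K]_n) (p q R T s t d A B C : K) (u v : 'rV[K]_n -> K -> K).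

Lemma within_time_slice R T u b t0 : cball R b -> t0 < T ->
  {within cball R `*` `[0, T[, continuous (uncurried u)} ->
  {within `[0, t0], continuous (u b)}.
Proof.
move=> bR t0T cu; apply: (within_continuous_comp (g := fun t => (b, t)) cu).
  by apply: continuous_pair; [exact: cst_continuous|move=> t; exact: cvg_id].
move=> t; rewrite /= in_itv /= => /andP[t1 t2].
by split => //=; rewrite in_itv /= t1 (le_lt_trans t2).
Qed.

(** Gives one truncation level of the barrier that serves both components. *)
Lemma exists_common_factor (al be A B : K) : 0 < al -> 0 < be -> 0 <= A -> 0 <= B ->
  exists2 C, A < al * C & B < be * C.
Proof.
move=> al0 be0 A0 B0.
have alA : al * (A / al) = A by rewrite mulrC divfK // gt_eqF.
have beB : be * (B / be) = B by rewrite mulrC divfK // gt_eqF.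
have Aal : 0 <= A / al by rewrite divr_ge0 // ltW.
have Bbe : 0 <= B / be by rewrite divr_ge0 // ltW.
have alB := mulr_ge0 (ltW al0) Bbe; have beA := mulr_ge0 (ltW be0) Aal.
by exists (A / al + B / be + 1); rewrite !mulrDr ?alA ?beB; lra.
Qed.

(** The argument is run at the first time [s <= t0] with both values at least those at [t0], because
    only there is every earlier pair known to fall short in some component. Exceeding the initial
    values at [t0] gives s > 0 and the sign condition at time 0. *)
Lemma boundary_persistence p q R T u v b t0 t : (0 < n)%N -> 1 < p -> 1 < q -> 0 < R ->
  radial_solution p q R T u v -> bdball R b ->
  (forall z, oball R z -> exists2 L, has_lap (u^~ 0) z L & 0 <= L) ->
  (forall z, oball R z -> exists2 L, has_lap (v^~ 0) z L & 0 <= L) ->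
  0 < t0 -> u b 0 < u b t0 -> v b 0 < v b t0 -> t0 <= t < T ->
  u b t0 <= u b t /\ v b t0 <= v b t.
Proof.
move=> n0 p1 q1 R0 sol bR subu subv t00 u0t v0t /andP[t0t tT].
have [[cu _ _] [cv _ _] uv0 _] := sol.
have bRc := bdball_cball bR; have t0T := le_lt_trans t0t tT.
have [s [/andP[s0 st0] us vs first]] := first_entry (ltW t00)
  (within_time_slice bRc t0T cu) (within_time_slice bRc t0T cv).
have {}s0 : 0 < s.
  rewrite lt_neqAle s0 andbT; apply/eqP => E.
  by move: us; rewrite -E leNgt u0t.
have sT : 0 < s < T by rewrite s0 (le_lt_trans st0).
have sT' : 0 <= s < T by case/andP: sT => /ltW -> ->.
have [A0 B0] := uv0 b s bRc sT'.
set A := u b s in us A0 *; set B := v b s in vs B0 *.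
have [C C1 C2] := exists_common_factor (expR_gt0 (B `^ p)) (expR_gt0 (A `^ q)) A0 B0.
have [H hH] := exists_harmonic_barrier C n0 R0.
have tu := tangent_from_below n0 (lt_trans ltr01 p1) R0 sol sT bR hH C1.
have tv := tangent_from_below n0 (lt_trans ltr01 q1) R0 (radial_solution_sym sol) sT bR hH C2.
have paretou s' : 0 < s' <= s -> A < u b s' -> v b s' <= B.
  move=> /andP[s'0]; rewrite le_eqVlt => /orP[/eqP ->|s's]; first by rewrite ltxx.
  move=> Au; have [|us'|vs'] := first s'; first by rewrite ltW.
    by move: Au; rewrite ltNge (ltW (lt_le_trans us' us)).
  exact: ltW (lt_le_trans vs' vs).
have paretov s' : 0 < s' <= s -> B < v b s' -> u b s' <= A.
  move=> s'I Bv; rewrite leNgt; apply/negP => /(paretou s' s'I).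
  by rewrite leNgt Bv.
have [] := stay_above p1 q1 R0 sol (ltW s0) bR hH A0 B0 C1 C2
  (tu (ltW (lt_le_trans u0t us)) paretou subu) (tv (ltW (lt_le_trans v0t vs)) paretov subv)
  (t := t).
  by rewrite tT (le_trans st0).
by move=> Au Bv; split; [exact: le_trans us Au|exact: le_trans vs Bv].
Qed.

Lemma ler_max_cball R (w : 'rV[K]_n -> K) b C : cball R b ->
  (forall x, cball R x -> w x <= C) -> max_cball R w <= C.
Proof.
move=> bR wC; apply: ge_sup; first by exists (w b), b.
by move=> _ [x xR <-]; exact: wC.
Qed.

Lemma bounded_not_blow_up p q R T (u0 v0 : 'rV[K]_n -> K) u v b C : 0 < T -> cball R b ->
  (forall x t, cball R x -> 0 < t < T -> u x t <= C /\ v x t <= C) ->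
  ~ blows_up_at p q R u0 v0 T u v.
Proof.
move=> T0 bR bnd [_ sup_infty].
pose f t := (max_cball R (fun x => u x t) + max_cball R (fun x => v x t))%:E.
have : (limf_esup f (T^'-) <= (C + C)%:E)%E.
  apply: (@le_trans _ _ (ereal_sup [set f t | t in [set t | 0 < t < T]])).
    apply: ereal_inf_lbound; exists [set t | 0 < t < T] => //.
    near=> t; apply/andP; split; near: t.
      exact: nbhs_left_gt.
    exact: nbhs_left_lt.
  apply: ge_ereal_sup => _ [t tT <-]; rewrite lee_fin; apply: lerD.
    by apply: (ler_max_cball bR) => x xR; case: (bnd x t xR tT).
  by apply: (ler_max_cball bR) => x xR; case: (bnd x t xR tT).
by rewrite sup_infty leye_eq.
Unshelve. all: by end_near. Qed.

(** Otherwise, whenever one boundary value exceeds its initial value, the other does not, and the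
    flux of the first is bounded by a constant. A quadratic barrier then bounds both functions on
    the whole of [0, T). *)
Lemma exists_time_above_initial p q R T (u0 v0 : 'rV[K]_n -> K) u v b :
  0 < p -> 0 < q -> 0 < R -> 0 < T ->
  radial_solution p q R T u v -> bdball R b -> blows_up_at p q R u0 v0 T u v ->
  exists2 t, 0 < t < T & u b 0 < u b t /\ v b 0 < v b t.
Proof.
move=> p0 q0 R0 T0 sol bR blow; have bRc := bdball_cball bR.
apply: contrapT => none.
have alt t : 0 < t < T -> u b t <= u b 0 \/ v b t <= v b 0.
  move=> tT; have [H|H] := lerP (u b t) (u b 0); [by left|right].
  by rewrite leNgt; apply/negP => H'; apply: none; exists t.
have half p' q' u' v' : 0 < p' -> radial_solution p' q' R T u' v' ->
    (forall t, 0 < t < T -> u' b t <= u' b 0 \/ v' b t <= v' b 0) ->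
    exists C, forall x t, cball R x -> 0 < t < T -> u' x t <= C.
  move=> p'0 [hu hv uv0 rad] alt'.
  have [m Hm] := within_segment_bounded T0 (let: And3 c _ _ := hu in c).
  have zz : 0 <= (0 : K) <= 0 by rewrite lexx.
  pose k := expR (v' b 0 `^ p') / (2 * R).
  have k0 : 0 <= k by rewrite divr_ge0 ?expR_ge0 // mulr_ge0 // ltW.
  have kE : 2 * k * R = expR (v' b 0 `^ p') by rewrite /k; field; rewrite gt_eqF.
  exists (m + k * (R ^+ 2 + 2 * n%:R * T)) => x t xR /andP[t0 tT].
  apply: (@le_trans _ _ (m + k * (sqn x + 2 * n%:R * t))); last first.
    rewrite lerD2l ler_wpM2l // lerD ?sqn_cball //.
    by rewrite ler_wpM2l ?mulr_ge0 // ltW.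
  apply: (upper_barrier R0 hu k0 _ _ _ xR).
  - by rewrite tT ltW.
  - by move=> y yR; exact: Hm.
  - move=> y s yR /andP[s0 st] mu.
    have sT : 0 < s < T by rewrite s0 (le_lt_trans st).
    have sT' : 0 <= s < T by case/andP: sT => /ltW -> ->.
    have yb : enorm y = enorm b by rewrite (yR : enorm y = R) (bR : enorm b = R).
    have [uyb vyb] := rad y b s (bdball_cball yR) bRc yb sT'.
    have [H|H] := alt' s sT.
      by move: mu; rewrite uyb ltNge (le_trans H) // Hm.
    rewrite kE vyb; apply: exp_power_mono (ltW p'0) _ _ _ H.
    by case: (uv0 b s bRc sT').
have [Cu HCu] := half p q u v p0 sol alt.
have alt2 t : 0 < t < T -> v b t <= v b 0 \/ u b t <= u b 0 by move=> /alt[]; [right|left].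
have [Cv HCv] := half q p v u q0 (radial_solution_sym sol) alt2.
apply: (@bounded_not_blow_up p q R T u0 v0 u v b (Num.max Cu Cv) T0 bRc _ blow).
by move=> x t xR tT; rewrite !le_max HCu // HCv // orbT.
Qed.

(** The barrier with k = 0, a constant: up to time [t] the boundary values never exceed it, so its
    flux condition holds vacuously. *)
Lemma max_cball_le_boundary R T u a b ts C t : 0 < R -> heat_flux R T u a -> bdball R b ->
  (forall x s, bdball R x -> 0 <= s < T -> u x s = u b s) ->
  (forall x s, cball R x -> 0 <= s <= ts -> u x s <= C) ->
  (forall s, ts <= s <= t -> u b s <= u b t) -> 0 <= ts -> ts <= t < T ->
  max_cball R (fun x => u x t) <= Num.max C (u b t).
Proof.
move=> R0 hu bR rad HC mono ts0 /andP[tst tT].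
apply: (ler_max_cball (bdball_cball bR)) => x xR.
have t0T : 0 <= t < T by rewrite tT (le_trans ts0).
suff : u x t <= Num.max C (u b t) + 0 * (sqn x + 2 * n%:R * t) by rewrite mul0r addr0.
apply: (upper_barrier R0 hu (lexx 0) t0T _ _ xR).
  by move=> y yR; rewrite le_max HC // lexx.
move=> y s yR /andP[s0 st]; rewrite gt_max => /andP[Cu bu]; exfalso.
have sT : 0 <= s < T by rewrite ltW //= (le_lt_trans st).
have [sts|tss] := lerP s ts.
  by move: Cu; rewrite ltNge HC ?(ltW s0) //; exact: bdball_cball.
by move: bu; rewrite rad // ltNge mono // (ltW tss).
Qed.

Lemma blow_up_rate p q R T u v b ts gam : (0 < n)%N -> 1 < p -> 1 < q -> 0 < R ->
  radial_solution p q R T u v -> bdball R b -> 0 < gam ->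
  0 < ts < T ->
  (forall s t, ts <= s -> s <= t -> t < T -> u b s <= u b t /\ v b s <= v b t) ->
  exists2 C1, 0 < C1 & forall t, 0 < t < T ->
    max_cball R (fun x => u x t) <= ln C1 - gam * ln (T - t).
Proof.
move=> n0 p1 q1 R0 [hu hv uv0 rad] bR gam0 /andP[ts0 tsT] mono.
have bRc := bdball_cball bR.
have cu : {within cball R `*` `[0, T[, continuous (uncurried u)} by case: hu.
have radb x s : bdball R x -> 0 <= s < T -> u x s = u b s /\ v x s = v b s.
  move=> xR sT; apply: rad => //; first exact: bdball_cball.
  by rewrite (xR : enorm x = R) (bR : enorm b = R).
have [m Hm] := within_segment_bounded tsT cu.
pose c := n%:R / R.
have c0 : 0 < c by rewrite divr_gt0 // ltr0n.
have pos t : ts <= t < T -> 0 <= u b t /\ 0 <= v b t.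
  by move=> /andP[tst tT]; apply: uv0 => //; rewrite tT (le_trans (ltW ts0)).
have bnd t : ts <= t < T -> exists C, forall s, ts <= s <= t -> u b s <= C /\ v b s <= C.
  move=> /andP[tst tT]; exists (Num.max (u b t) (v b t)) => s /andP[tss st].
  by have [us vs] := mono s t tss st tT; rewrite !le_max us vs orbT.
have grow s t : ts <= s -> s <= t -> t < T ->
    c * (t - s) * expR (v b s `^ p) <= u b t /\ c * (t - s) * expR (u b s `^ q) <= v b t.
  move=> tss st tT; have s0 : 0 < s by exact: lt_le_trans tss.
  have sT : 0 <= s < T by rewrite (ltW s0) (le_lt_trans st).
  have [us vs] := uv0 b s bRc sT.
  have H x r : bdball R x -> s < r <= t -> [/\ u x r = u b r, v x r = v b r,
      u b s <= u b r & v b s <= v b r].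
    move=> xR /andP[sr rt]; have rT : r < T by exact: le_lt_trans tT.
    have rT' : 0 <= r < T by rewrite rT ltW // (lt_trans s0).
    have [-> ->] := radb x r xR rT'.
    by have [] := mono s r tss (ltW sr) rT.
  split.
    apply: (lower_barrier R0 hu (expR_ge0 _) (ltW s0) st tT) => //.
      by move=> x xR; case: (uv0 x s xR sT).
    by move=> x r xR sr; have [_ -> _ Hv] := H x r xR sr; apply: exp_power_mono Hv => //; lra.
  apply: (lower_barrier R0 hv (expR_ge0 _) (ltW s0) st tT) => //.
    by move=> x xR; case: (uv0 x s xR sT).
  by move=> x r xR sr; have [-> _ Hu _] := H x r xR sr; apply: exp_power_mono Hu => //; lra.
have [C HC] := alternating_growth_bound p1 q1 c0 gam0 pos bnd grow.
(* [m] covers times up to [ts], [C] the later ones, and the last term keeps L - gam ln(T - t)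
   nonnegative when T - t > 1. *)
pose L := `|m| + `|C| + gam * `|ln T|.
have T0 : 0 < T by exact: lt_trans tsT.
exists (expR L); first exact: expR_gt0.
move=> t /andP[t0 tT]; rewrite expRK.
have lnT : gam * ln (T - t) <= gam * `|ln T|.
  rewrite ler_pM2l //; apply: le_trans (ler_norm _).
  by rewrite ler_ln ?posrE ?subr_gt0 // gerBl ltW.
have gT : 0 <= gam * `|ln T| by rewrite mulr_ge0 // ltW.
have m1 := ler_norm m; have m2 := normr_ge0 m; have C1 := ler_norm C; have C2 := normr_ge0 C.
have [tts|tst] := lerP t ts.
  apply: (@le_trans _ _ m); last by rewrite /L; lra.
  by apply: (ler_max_cball bRc) => x xR; apply: Hm => //; rewrite (ltW t0).
have tI : ts <= t < T by rewrite ltW.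
have := max_cball_le_boundary R0 hu bR (fun x s xR sT => (radb x s xR sT).1) Hm
  (fun s sI => (mono s t (proj1 (andP sI)) (proj2 (andP sI)) tT).1) (ltW ts0) tI.
move=> /le_trans; apply; rewrite ge_max; apply/andP; split; first by rewrite /L; lra.
apply: le_trans (HC t tI) _; rewrite ge_max; apply/andP; split; rewrite /L; lra.
Qed.

End BlowUpRate.

Unset Implicit Arguments.

Theorem theorem3p4 (K : realType) (n : nat) (p q R T : K)
    (u0 v0 : 'rV[K]_n -> K) (u v : 'rV[K]_n -> K -> K)
    (n_gt0 : (0 < n)%N) (p_gt1 : 1 < p) (q_gt1 : 1 < q)
    (R_gt0 : 0 < R) (T_gt0 : 0 < T)
    (u0_smooth : smooth_cball R u0) (v0_smooth : smooth_cball R v0)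
    (u0_radial : radially_symmetric R u0)
    (v0_radial : radially_symmetric R v0)
    (u0_neq0 : exists2 x, cball R x & u0 x != 0)
    (v0_neq0 : exists2 x, cball R x & v0 x != 0)
    (u0_ge0 : forall x : 'rV[K]_n, cball R x -> 0 <= u0 x)
    (v0_ge0 : forall x : 'rV[K]_n, cball R x -> 0 <= v0 x)
    (u0_lap : forall x : 'rV[K]_n, oball R x -> 0 <= laplacian u0 x)
    (v0_lap : forall x : 'rV[K]_n, oball R x -> 0 <= laplacian v0 x)
    (u0_r : forall x : 'rV[K]_n, cball R x -> 0 <= radial_deriv R u0 (enorm x))
    (v0_r : forall x : 'rV[K]_n, cball R x -> 0 <= radial_deriv R v0 (enorm x))
    (uv_sol : classical_solution p q R u0 v0 T u v)
    (uv_blowup : blows_up_at p q R u0 v0 T u v) :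
  let alpha := (p + 1) / (p * q - 1) in
  let beta := (q + 1) / (p * q - 1) in
  exists C1 C2 : K, 0 < C1 /\ 0 < C2 /\
    forall t : K, 0 < t < T ->
      max_cball R (fun x => u x t) <= ln C1 - alpha / 2 * ln (T - t) /\
      max_cball R (fun x => v x t) <= ln C2 - beta / 2 * ln (T - t).
Proof.
move=> alpha beta.
have cu0 := u0_smooth.1; have cv0 := v0_smooth.1.
have sol := classical_solution_radial p_gt1 q_gt1 R_gt0 T_gt0 cu0 cv0 u0_radial v0_radial uv_sol.
pose b := R *: (delta_mx ord0 (Ordinal n_gt0) : 'rV[K]_n).
have bR : bdball R b by rewrite /bdball /= enormZ enorm_delta mulr1 gtr0_norm.
have [_ _ _ _ [_ init]] := uv_sol.
have sub (w0 : 'rV[K]_n -> K) (w : 'rV[K]_n -> K -> K) : smooth_cball R w0 ->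
    (forall x, oball R x -> 0 <= laplacian w0 x) -> (forall x, oball R x -> w x 0 = w0 x) ->
    forall z, oball R z -> exists2 L, has_lap (w^~ 0) z L & 0 <= L.
  move=> [_ smooth] lap0 ww0 z zR; exists (laplacian w0 z); last exact: lap0.
  apply: (has_lap_local (@open_oball K n R) zR (w := w0)); first by move=> y /ww0.
  apply: (has_lap_laplacian zR).
    by move=> i y yR; exact: (smooth [::]).1.
  by move=> i; exact: (smooth [:: i]).1.
have subu := sub _ _ u0_smooth u0_lap (fun x xR => (init x xR).1).
have subv := sub _ _ v0_smooth v0_lap (fun x xR => (init x xR).2).
have p0 : 0 < p by lra.
have q0 : 0 < q by lra.
have [ts tsT [uts vts]] := exists_time_above_initial p0 q0 R_gt0 T_gt0 sol bR uv_blowup.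
have [ts0 tsT'] := andP tsT.
have persist := boundary_persistence n_gt0 p_gt1 q_gt1 R_gt0 sol bR subu subv.
(* Persistence is used twice: from [ts] to [s], so that the values at [s] also exceed the initial
   ones, and then from [s] to [t]. *)
have mono s t : ts <= s -> s <= t -> t < T -> u b s <= u b t /\ v b s <= v b t.
  move=> tss st tT.
  have [us vs] : u b ts <= u b s /\ v b ts <= v b s.
    by apply: persist => //; rewrite tss (le_lt_trans st).
  apply: persist; last by rewrite st.
  - exact: lt_le_trans tss.
  - exact: lt_le_trans us.
  - exact: lt_le_trans vs.
(* Makes alpha / 2 and beta / 2 positive, hence admissible values of [gam] in [blow_up_rate]. *)
have pq : 0 < p * q - 1 by nra.
have alpha0 : 0 < alpha / 2 by rewrite !divr_gt0 // addr_gt0.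
have beta0 : 0 < beta / 2 by rewrite !divr_gt0 // addr_gt0.
have [C1 C10 H1] := blow_up_rate n_gt0 p_gt1 q_gt1 R_gt0 sol bR alpha0 tsT mono.
have mono' s t : ts <= s -> s <= t -> t < T -> v b s <= v b t /\ u b s <= u b t.
  by move=> tss st tT; have [] := mono s t tss st tT.
have [C2 C20 H2] := blow_up_rate n_gt0 q_gt1 p_gt1 R_gt0 (radial_solution_sym sol) bR
  beta0 tsT mono'.
by exists C1, C2; split => //; split => // t tT; split; [exact: H1|exact: H2].
Qed.
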